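(* Consider either the group lasso $$\hat\beta_t=\operatorname{argmin}\left\{n^{-1}\|Y-\mathbb{X}\beta\|_2^2:\ \sum_{g\in G}\sqrt{|g|}\,\|\beta_g\|_2\le t\right\},$$ or the square-root lasso $$\hat\beta_t=\operatorname{argmin}\left\{n^{-1}\|Y-\mathbb{X}\beta\|_2:\ \|\beta\|_1\le t\right\}.$$ Let $1\le q\le\infty$, let $(\mu_n)\in\mathcal{F}_q$, and suppose that the validation sets $V_n$ satisfy: as $n\to\infty$, for all $v\in V_n$, $|v|\asymp c_n$ for some sequence $c_n$. Define $b_n=\min\{n-c_n,c_n\}$, let $m_n$ be any sequence tending to infinity with $m_n=o(b_n^{1/4})$, and let $$a_n=\frac{n(\log p)^{1/4+1/(2q)}m_n}{b_n^{1/4}},\qquad t_n=o\left(\frac{b_n^{1/4}}{m_n(\log p)^{1/4+1/(2q)}}\right).$$ Let $t_{\max}=\|Y\|_2^2/a_n$ and let $\hat t$ be the minimizer of the cross-validation risk over $T=[0,t_{\max}]$. Then, for every $\delta>0$, for $n$ large enough, $\log(p)=o(b_n^{q/(q+2)})$, and $\max_{g\in G}\sqrt{|g|}=O(1)$, we have $$\mathbb{P}_{\mu_n}\left(\mathcal{E}(\hat t,t_n)>\delta\right)\le\frac{1}{m_n^2\delta}\left(1+\sqrt{\frac{b_n}{n}}\right)+2\exp\left(-\frac{n}{8e^2}\right).$$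
   Context: For each $n$, let $p=p_n$ (allowed to grow with $n$), and let $Z_i^\top=(Y_i,X_i^\top)$, $i=1,\ldots,n$, be i.i.d. from a distribution $\mu_n$, with $Y_i\in\mathbb{R}$ and $X_i\in\mathbb{R}^p$. Let $\mathcal{Z}^\top=(\mathcal{Y},\mathcal{X}^\top)\sim\mu_n$ be a new independent draw, with zero-based indexing $\mathcal{Z}_0=\mathcal{Y}$. The model is $\mathcal{Y}=f^*(\mathcal{X})+\epsilon$ with $\epsilon$ and $\mathcal{X}$ independent and $f^*$ an unknown (not necessarily linear) function. Write $Y=(Y_1,\ldots,Y_n)^\top$ and $\mathbb{X}=[X_1,\ldots,X_n]^\top\in\mathbb{R}^{n\times p}$. $G$ is a partition of $\{1,\ldots,p\}$ into groups $g$, $|g|$ is the size of $g$, and $\beta_g=(\beta_j)_{j\in g}$. Distribution class: for a nondecreasing convex $\psi$ with $\psi(0)=0$, $\|\xi\|_\psi=\inf\{c>0:\mathbb{E}\,\psi(|\xi|/c)\le1\}$, and $\|\cdot\|_{\psi_q}$ denotes this norm for $\psi_q(x)=\exp(x^q)-1$. For $1\le q<\infty$ and a constant $C_q$ independent of $n$, $\mathcal{F}_q$ is the set of sequences $(\mu_n)$ of distributions such that, for $\xi\sim\mu_n$, $\max_{0\le j,k\le p}\|\xi_j\xi_k-\mathbb{E}_{\mu_n}\xi_j\xi_k\|_{\psi_q}\le C_q$. $\mathcal{F}_\infty$ is the analogous set of $(\mu_n)$ with $|\xi_j|\le C_\infty$ almost surely for each $j$. Convention when $q=\infty$: $c/\infty=0$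 for $0<c<\infty$ and $\infty/\infty=1$ (so $q/(q+2)=1$). Risk: $R(\beta)=\mathbb{E}_{\mu_n}[(\mathcal{Y}-\mathcal{X}^\top\beta)^2]$; for an estimator $\hat\beta$, $R(\hat\beta)=\mathbb{E}_{\mu_n}[(\mathcal{Y}-\mathcal{X}^\top\hat\beta)^2\mid Z_1,\ldots,Z_n]$. Oracle and excess risk: $\beta_t=\operatorname{argmin}_{\beta\in\mathcal{B}_t}R(\beta)$ and $\mathcal{E}(\hat t,t)=R(\hat\beta_{\hat t})-R(\beta_t)$, where $\mathcal{B}_t=\{\beta:\|\beta\|_1\le t\}$ for the square-root lasso and $\mathcal{B}_t=\{\beta:\sum_{g\in G}\sqrt{|g|}\|\beta_g\|_2\le t\}$ for the group lasso. Cross-validation: $V_n=\{v_1,\ldots,v_K\}$ is a set of validation sets $v\subset\{1,\ldots,n\}$, $\hat\beta^{(v)}_t$ is the estimator $\hat\beta_t$ under consideration computed with the observations in $v$ removed, and $\hat R_{V_n}(t)=\frac1K\sum_{v\in V_n}\frac1{|v|}\sum_{r\in v}(Y_r-X_r^\top\hat\beta^{(v)}_t)^2$. The selected parameter is $\hat t=\operatorname{argmin}_{t\in T}\hat R_{V_n}(t)$.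
   Formalization: Two conditions are added because the literal claim fails without them: training sizes n-|v| are at least a constant times n-c_n, uniformly over v in V_n, and for q finite the second moment of the response is bounded in n; also p is at least 2 for large n, so that log p > 0. *)

(* Defs.v *)
From HB Require Import structures.
From mathcomp Require Import all_boot all_order all_algebra.
From mathcomp Require Import all_classical all_reals all_analysis.

Set Implicit Arguments.
Unset Strict Implicit.
Unset Printing Implicit Defensive.

Import Order.TTheory GRing.Theory Num.Theory.
Import numFieldNormedType.Exports.

Local Open Scope classical_set_scope.
Local Open Scope ring_scope.

Definition is_argmin (R : realType) (T : Type) (D : set T) (F : T -> R)
    (x : T) : Prop :=
  D x /\ forall y, D y -> F x <= F y.

(* An observation is a point z = (z_0, z_1, ..., z_p) of R^(p+1): z_0 is the
   response and (z_1, ..., z_p) the vector of covariates. *)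
Definition response (R : realType) (p : nat) (z : p.+1.-tuple R) : R :=
  tnth z ord0.

Definition covariates (R : realType) (p : nat) (z : p.+1.-tuple R) :
    p.-tuple R :=
  [tuple tnth z (lift ord0 j) | j < p].

Definition residual (R : realType) (p : nat) (z : p.+1.-tuple R)
    (beta : 'cV[R]_p) : R :=
  response z - \sum_(j < p) tnth (covariates z) j * beta j ord0.

(* The regression model Y = f(X) + eps with eps independent of X, read as a
   property of the joint law mu of (Y, X): eps is recovered as Y - f(X). *)
Definition regression_model (R : realType) (p : nat)
    (mu : probability (p.+1.-tuple R) R) (f : p.-tuple R -> R) : Prop :=
  let eps z := response z - f (covariates z) in
  measurable_fun [set: p.-tuple R] f /\
  forall (A : set R) (B : set (p.-tuple R)), measurable A -> measurable B ->
    mu ((eps @^-1` A) `&` (@covariates R p @^-1` B)) =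
    (mu (eps @^-1` A) * mu (@covariates R p @^-1` B))%E.

(* The argmins below are arbitrary selections, so the events of interest need
   not be measurable; on measurable sets this is P itself. *)
Definition outer_probability (R : realType) (d : measure_display)
    (T : measurableType d) (P : probability T R) (A : set T) : \bar R :=
  mu_ext P A.

Definition orlicz_norm (R : realType) (d : measure_display)
    (T : measurableType d) (P : probability T R) (psi : R -> R) (xi : T -> R) :
    \bar R :=
  ereal_inf [set c%:E | c in
    [set c : R | 0 < c /\ ('E_P[fun w => psi (`|xi w| / c)%R] <= 1)%E]].

Definition psi_exp (R : realType) (q x : R) : R := expR (x `^ q) - 1.

(* z_j z_k - E z_j z_k.  No integrability side condition is needed for the use
   of fine below: if z_j z_k were not integrable, then fine would return 0, and
   a finite Orlicz norm of z_j z_k itself would make it integrable. *)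
Definition centered_product (R : realType) (p : nat)
    (mu : probability (p.+1.-tuple R) R) (j k : 'I_p.+1) (z : p.+1.-tuple R) :
    R :=
  tnth z j * tnth z k - fine 'E_mu[fun z' => (tnth z' j * tnth z' k)%R].

Definition in_class (R : realType) (q : \bar R) (p : nat -> nat)
    (mu : forall n, probability ((p n).+1.-tuple R) R) : Prop :=
  exists C : R, forall n,
    match q with
    | r%:E => forall j k : 'I_(p n).+1,
        (orlicz_norm (mu n) (psi_exp r) (centered_product (mu n) j k)
          <= C%:E)%E
    | +oo%E => forall j : 'I_(p n).+1, {ae mu n, forall z, `|tnth z j| <= C}
    | -oo%E => False
    end.

(* 1/(2q) and q/(q+2), with the values 0 and 1 at q = +oo. *)
Definition inv2q (R : realType) (q : \bar R) : R :=
  if q is r%:E then (2 * r)^-1 else 0.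

Definition q_over_q2 (R : realType) (q : \bar R) : R :=
  if q is r%:E then r / (r + 2) else 1.

(* Independence of all n events implies it for every subfamily, since the
   remaining sets may be taken to be the whole space. *)
Definition iid_sample (R : realType) (d : measure_display)
    (Omega : measurableType d) (P : probability Omega R) (d' : measure_display)
    (T : measurableType d') (mu : probability T R) (n : nat)
    (Z : 'I_n -> {RV P >-> T}) : Prop :=
  (forall i (A : set T), measurable A -> P (Z i @^-1` A) = mu A) /\
  (forall A : 'I_n -> set T, (forall i, measurable (A i)) ->
    P (\bigcap_(i in [set: 'I_n]) (Z i @^-1` A i)) =
    (\prod_(i < n) fine (P (Z i @^-1` A i)))%:E).

(* The conditional risk of an estimator given the data is this function
   evaluated at the value of the estimator, the new draw being independent of
   the data. *)
Definition risk (R : realType) (p : nat)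
    (mu : probability (p.+1.-tuple R) R) (beta : 'cV[R]_p) : R :=
  fine 'E_mu[fun z => (residual z beta ^+ 2)%R].

Inductive lasso := GroupLasso | SqrtLasso.

Definition penalty (R : realType) (k : lasso) (p : nat)
    (G : {set {set 'I_p}}) (beta : 'cV[R]_p) : R :=
  match k with
  | GroupLasso => \sum_(g in G)
      Num.sqrt #|g|%:R * Num.sqrt (\sum_(j in g) beta j ord0 ^+ 2)
  | SqrtLasso => \sum_(j < p) `|beta j ord0|
  end.

Definition constraint_set (R : realType) (k : lasso) (p : nat)
    (G : {set {set 'I_p}}) (t : R) : set 'cV[R]_p :=
  [set beta | penalty k G beta <= t].

(* The objective computed from the observations indexed by A only. *)
Definition objective (R : realType) (k : lasso) (n p : nat)
    (z : 'I_n -> p.+1.-tuple R) (A : {set 'I_n}) (beta : 'cV[R]_p) : R :=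
  let rss := \sum_(i in A) residual (z i) beta ^+ 2 in
  match k with
  | GroupLasso => #|A|%:R^-1 * rss
  | SqrtLasso => #|A|%:R^-1 * Num.sqrt rss
  end.

(* beta is a value at t of the estimator computed with the observations in v
   removed; v = set0 gives the full-sample estimator. *)
Definition is_estimate (R : realType) (k : lasso) (n p : nat)
    (G : {set {set 'I_p}}) (z : 'I_n -> p.+1.-tuple R) (v : {set 'I_n}) (t : R)
    (beta : 'cV[R]_p) : Prop :=
  is_argmin (constraint_set k G t) (objective k z (~: v)%SET) beta.

Definition cv_risk (R : realType) (n p : nat) (V : {set {set 'I_n}})
    (z : 'I_n -> p.+1.-tuple R) (betahat : {set 'I_n} -> R -> 'cV[R]_p)
    (t : R) : R :=
  #|V|%:R^-1 *
    \sum_(v in V) #|v|%:R^-1 * \sum_(r in v) residual (z r) (betahat v t) ^+ 2.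

(* Main.v *)
Require Import Defs.
From HB Require Import structures.
From mathcomp Require Import all_boot all_order all_algebra.
From mathcomp Require Import all_classical all_reals all_analysis.
From mathcomp Require Import measurable_realfun.
From mathcomp Require Import ring lra.

Set Implicit Arguments.
Unset Strict Implicit.
Unset Printing Implicit Defensive.

Import Order.TTheory GRing.Theory Num.Theory.
Import numFieldNormedType.Exports.

Local Open Scope classical_set_scope.
Local Open Scope ring_scope.

(** The excess risk is controlled by how far empirical second moments are from
    population ones.  With gamma = (1, - beta) the residual of z is the linear
    form gamma . z, so for every index set A the empirical risk over A minus the
    risk is the quadratic form sum_jk gamma_j gamma_k Delta_A(j, k), where
    Delta_A(j, k) averages z_j z_k - E z_j z_k over A.  On the l1 ball of radius
    B (which contains the constraint sets of both lassos, by Cauchy-Schwarz in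
    each group) this is at most (1 + B)^2 err_A with err_A = max |Delta_A|
    ([emp_risk_uniform]).

    Oracle inequality ([cv_oracle]).  Going from the full-sample estimator to
    the leave-v-out ones, then to their validation risk, then using that the
    selected parameter minimizes the cross-validation risk, and then going back,
    one never leaves the ball of radius tmax, and each change of empirical
    measure costs one err_A.  Hence the selected estimator is within
    2 (1 + B)^2 cv_error of any beta in a constraint set of level s <= tmax,
    where cv_error averages err over the whole sample, v and its complement,
    v ranging over V.  When E Y^2 >= delta / 2, concentration of the mean of Y^2
    gives t_n <= tmax and one compares with the oracle itself; otherwise the
    null vector already has risk below delta / 2, and one compares with it
    ([excess_risk_le]).

    Tail of cv_error ([cv_error_tail]).  For every q >= 1, also infinite, the
    centered products have a uniformly bounded exponential moment, whence a
    Gaussian-type bound on their moment generating function near 0 and, by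
    independence, on that of their averages.  V may have exponentially many
    elements, so a union bound over V is not affordable; but cv_error is an
    average over V, so that convexity of exp and Markov's inequality give a tail
    whose only entropy factor is 2 (p + 1)^2.

    Rates ([tail_bound_le]).  With B of order b^(1/4) / (m (log p)^(1/4+1/(2q))),
    the deviation s = eta / (1 + B)^2 to be excluded satisfies
    b s^2 >> log p + m^2, so the tail is eventually below
    exp (- delta m^2) <= 1 / (delta m^2), which is the first term of the bound
    that is claimed; the other terms only add to it. *)

(** * Expectation of products over an i.i.d. sample *)

Section product_expectation.
Context (R : realType).
Import HBNNSimple.

(** Both sides are measures in A that agree by assumption, so they integrate
    every nonnegative h equally: the identity passes from indicators to simple
    functions by linearity, and to h by monotone convergence. *)
Lemma integral_weight_comp (d d' : measure_display) (Omega : measurableType d)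
    (T : measurableType d') (P : {measure set Omega -> \bar R})
    (mu : {measure set T -> \bar R}) (X : Omega -> T) (W : Omega -> R)
    (c : R) :
  measurable_fun setT X -> measurable_fun setT W -> (forall w, 0 <= W w) ->
  0 <= c ->
  (forall A, measurable A ->
    (\int[P]_w (W w * \1_A (X w))%:E = c%:E * mu A)%E) ->
  forall h : T -> R, measurable_fun setT h -> (forall z, 0 <= h z) ->
    (\int[P]_w (W w * h (X w))%:E = c%:E * \int[mu]_z (h z)%:E)%E.
Proof.
move=> mX mW W0 c0 WP h mh h0.
have mhE : measurable_fun [set: T] (EFin \o h) by exact/measurable_EFinP.
pose phi := nnsfun_approx measurableT mhE.
have phi_cvg z : (EFin \o phi ^~ z) @ \oo --> (h z)%:E.
  by apply: (cvg_nnsfun_approx measurableT mhE) => // x _; rewrite lee_fin.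
have phi_nd z : {homo (fun n => phi n z) : m n / (m <= n)%N >-> m <= n}.
  by move=> m n mn; apply/lefP/nd_nnsfun_approx.
have mphiX n : measurable_fun setT (fun w => phi n (X w)).
  by apply: measurableT_comp.
have -> : (\int[mu]_z (h z)%:E = limn (fun n => \int[mu]_z (phi n z)%:E))%E.
  rewrite -monotone_convergence//=.
  - by apply: eq_integral => z _; apply/esym/cvg_lim => //; exact: phi_cvg.
  - by move=> n; exact/measurable_EFinP.
  - by move=> n z _; rewrite lee_fin.
  - by move=> z _ m n mn; rewrite lee_fin; exact: phi_nd.
have -> : (\int[P]_w (W w * h (X w))%:E =
    limn (fun n => \int[P]_w (W w * phi n (X w))%:E))%E.
  rewrite -monotone_convergence//=.
  - apply: eq_integral => w _; apply/esym/cvg_lim => //.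
    by under eq_fun do rewrite EFinM; rewrite EFinM; apply: cvgeZl => //; exact: phi_cvg.
  - by move=> n; apply/measurable_EFinP; exact: measurable_funM.
  - by move=> n w _; rewrite lee_fin mulr_ge0.
  - by move=> w _ m n mn; rewrite lee_fin ler_wpM2l//; exact: phi_nd.
have phi_int n : (\int[P]_w (W w * phi n (X w))%:E =
    c%:E * \int[mu]_z (phi n z)%:E)%E.
  have mI r : measurable (phi n @^-1` [set r]) by [].
  have mIX r : measurable_fun setT (fun w => \1_(phi n @^-1` [set r]) (X w) : R).
    exact: (measurableT_comp (measurable_indic (mI r)) mX).
  transitivity (\int[P]_w (\sum_(y \in range (phi n))
      (W w * (y * \1_(phi n @^-1` [set y]) (X w)))%:E))%E.
    apply: eq_integral => w _; rewrite fimfunE fsumEFin// !fsbig_finite//=.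
    by rewrite mulr_sumr.
  have range_ge0 y : y \in range (phi n) -> 0 <= y.
    by move=> /set_mem[z _ <-].
  have ind_ge0 y z : 0 <= y * \1_(phi n @^-1` [set y]) z :> R.
    rewrite indicE; have [/set_mem/= <-|_] := boolP (z \in _).
      by rewrite mulr_ge0.
    by rewrite mulr0.
  rewrite ge0_integral_fsum//; last 2 first.
  - move=> y; apply/measurable_EFinP; apply: measurable_funM => //.
    exact: measurable_funM.
  - by move=> y w _; rewrite lee_fin mulr_ge0.
  transitivity (\sum_(y \in range (phi n)) c%:E * (y%:E * mu (phi n @^-1` [set y])))%E.
    apply: eq_fsbigr => y /range_ge0 y0.
    under eq_integral do rewrite mulrCA EFinM.
    rewrite ge0_integralZl//; last 2 first.
    - by apply/measurable_EFinP; exact: measurable_funM.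
    - by move=> w _; rewrite lee_fin mulr_ge0.
    by rewrite WP// muleCA.
  rewrite [in RHS](_ : \int[mu]_z (phi n z)%:E =
     \int[mu]_z (\sum_(y \in range (phi n)) (y * \1_(phi n @^-1` [set y]) z)%:E))%E; last first.
    by apply: eq_integral => z _; rewrite fimfunE fsumEFin.
  rewrite ge0_integral_fsum//; last 2 first.
  - by move=> y; apply/measurable_EFinP; exact: measurable_funM.
  - by move=> y z _; rewrite lee_fin.
  rewrite ge0_mule_fsumr; last first.
    by move=> y; apply: integral_ge0 => z _; rewrite lee_fin.
  apply: eq_fsbigr => y /range_ge0 y0; congr (_ * _)%E.
  under [RHS]eq_integral do rewrite EFinM.
  rewrite ge0_integralZl//; last by apply/measurable_EFinP.
  by rewrite integral_indic// setIT.
under eq_fun do rewrite phi_int.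
apply/cvg_lim => //; apply: cvgeZl => //.
apply: ereal_nondecreasing_is_cvgn => m n mn; apply: ge0_le_integral => //.
- by move=> z _; rewrite lee_fin.
- exact/measurable_EFinP.
- exact/measurable_EFinP.
- by move=> z _; rewrite lee_fin; exact: phi_nd.
Qed.

(** Independence is given for events only.  It is transferred to functions one
    index at a time: with all factors but the k-th fixed, the expectation is a
    measure in the event that occupies the k-th place, to which
    [integral_weight_comp] applies. *)
Lemma iid_expectation_prod (d d' : measure_display) (Omega : measurableType d)
    (T : measurableType d') (P : probability Omega R) (mu : probability T R)
    (n : nat) (Z : 'I_n -> {RV P >-> T}) (h : 'I_n -> T -> R) (e : 'I_n -> R) :
  iid_sample mu Z ->
  (forall i, measurable_fun setT (h i)) -> (forall i z, 0 <= h i z) ->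
  (forall i, (\int[mu]_z (h i z)%:E = (e i)%:E)%E) ->
  (\int[P]_w (\prod_(i < n) h i (Z i w))%:E = (\prod_(i < n) e i)%:E)%E.
Proof.
move=> [lawZ indZ].
(* The families in which the factors of index at least k are indicators. *)
suff claim k : (forall (h : 'I_n -> T -> R) (e : 'I_n -> R),
    (forall i, measurable_fun setT (h i)) -> (forall i z, 0 <= h i z) ->
    (forall i, (\int[mu]_z (h i z)%:E = (e i)%:E)%E) ->
    (forall i : 'I_n, (k <= i)%N -> exists2 A, measurable A & h i = \1_A) ->
    (\int[P]_w (\prod_(i < n) h i (Z i w))%:E = (\prod_(i < n) e i)%:E)%E).
  move=> mh h0 he; apply: (claim n) => // i.
  by rewrite leqNgt ltn_ord.
elim: k => {h e} [|k IHk] h e mh h0 he hI.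
  have hI0 i : {A : set T | measurable A /\ h i = \1_A}.
    by apply: cid; have [//|A mA hA] := hI i; exists A.
  pose A i := sval (hI0 i).
  have mA i : measurable (A i) by rewrite /A; case: (hI0 i) => ? [].
  have hA i : h i = \1_(A i) by rewrite /A; case: (hI0 i) => ? [].
  have eA i : P (Z i @^-1` A i) = (e i)%:E.
    rewrite lawZ// -he; under eq_integral do rewrite hA.
    by rewrite integral_indic// setIT.
  transitivity (P (\bigcap_(i in [set: 'I_n]) (Z i @^-1` A i))).
    rewrite -[X in P X]setIT -integral_indic//; last first.
      apply: fin_bigcap_measurable => // i _.
      by rewrite -[X in measurable X]setTI; exact: measurable_funP.
    apply: eq_integral => w _; congr EFin; rewrite indicE.
    under eq_bigr do rewrite hA indicE.
    have [/set_mem/= wA|/negP wA] := boolP (w \in _).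
      by rewrite big1// => i _; rewrite mem_set//; exact: wA.
    have [i /negP wi] : exists i, ~ (Z i w \in A i).
      apply: contrapT => wi; apply: wA; apply/mem_set => i _ /=.
      by apply: contrapT => wAi; apply: wi; exists i => /set_mem.
    by rewrite (bigD1 i)//= (negbTE wi) mul0r.
  by rewrite indZ//; congr EFin; apply: eq_bigr => i _; rewrite eA.
have [nk|kn] := leqP n k.
  apply: IHk => // i ki; have := leq_trans nk ki.
  by rewrite leqNgt ltn_ord.
pose i0 := Ordinal kn.
pose W w := \prod_(i < n | i != i0) h i (Z i w).
pose c := \prod_(i < n | i != i0) e i.
have e0 i : 0 <= e i.
  by rewrite -lee_fin -he; apply: integral_ge0 => z _; rewrite lee_fin.
have mhZ i : measurable_fun setT (fun w => h i (Z i w)).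
  exact: measurableT_comp.
have -> : \prod_(i < n) e i = c * e i0 by rewrite (bigD1 i0)//= mulrC.
rewrite EFinM -he.
have -> : (fun w => (\prod_(i < n) h i (Z i w))%:E) =
    (fun w => (W w * h i0 (Z i0 w))%:E).
  by apply/funext => w; rewrite (bigD1 i0)//= mulrC.
apply: integral_weight_comp => //.
- rewrite /W; under eq_fun do rewrite -big_filter.
  by apply: measurable_prod => i _.
- by move=> w; exact: prodr_ge0.
- exact: prodr_ge0.
move=> A mA.
pose h' i := if i == i0 then \1_A else h i.
pose e' i := if i == i0 then fine (mu A) else e i.
have e'i0 : e' i0 = fine (mu A) by rewrite /e' eqxx.
have h'i0 : h' i0 = \1_A by rewrite /h' eqxx.
have := IHk h' e'; rewrite (bigD1 i0)//= e'i0.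
have -> : \prod_(i < n | i != i0) e' i = c.
  by apply: eq_bigr => i /negbTE i0i; rewrite /e' i0i.
have -> : (fun w => (\prod_(i < n) h' i (Z i w))%:E) =
    (fun w => (W w * \1_A (Z i0 w))%:E).
  apply/funext => w; rewrite (bigD1 i0)//= h'i0 mulrC; congr EFin.
  by congr (_ * _); apply: eq_bigr => i /negbTE i0i; rewrite /h' i0i.
have muA : (fine (mu A))%:E = mu A by rewrite fineK// fin_num_measure.
rewrite EFinM muA muleC; apply.
- by move=> i; rewrite /h'; case: ifP.
- by move=> i z; rewrite /h'; case: ifP.
- move=> i; rewrite /h' /e'; case: ifP => // _.
  by rewrite integral_indic// setIT muA.
- move=> i ki; rewrite /h'; case: ifPn => [_|i0i]; first by exists A.
  apply: hI; rewrite ltn_neqAle ki andbT.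
  by apply: contra i0i => /eqP ik; apply/eqP/val_inj.
Qed.

End product_expectation.

(** * Exponential moments and the distribution class *)

Section exponential_moments.
Context (R : realType).

(** Multiplying exp(- x) >= 1 - x by exp x gives exp x <= 1 + x exp x, and
    applying the elementary bound a second time gives the quadratic remainder. *)
Lemma expR_le_quadratic (x : R) : expR x <= 1 + x + x ^+ 2 * expR `|x|.
Proof.
have e0 := expR_gt0 x.
have ex : expR x <= 1 + x * expR x.
  have := ler_wpM2l (ltW e0) (expR_ge1Dx (- x)).
  rewrite -expRD subrr expR0; lra.
have ex1 := expR_ge1Dx x.
have [x0|x0] := leP 0 x.
  by rewrite ger0_norm//; nra.
have : 1 <= expR `|x| by rewrite -expR0 ler_expR.
by nra.
Qed.

Lemma sqr_le_expR (u : R) : 0 <= u -> u ^+ 2 <= 16 * expR (u / 2).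
Proof.
move=> u0; have -> : u / 2 = u / 4 + u / 4 by lra.
rewrite expRD; have := expR_ge1Dx (u / 4); nra.
Qed.

Lemma powR_ge_id (x r : R) : 0 <= x -> 1 <= r -> x <= 1 + x `^ r.
Proof.
move=> x0 r1; have [x1|x1] := leP x 1; first by have := powR_ge0 x r; lra.
have := ler_powR (ltW x1) r1; rewrite powRr1//; lra.
Qed.

Lemma exp_moment_integrable (d : measure_display) (T : measurableType d)
    (mu : {measure set T -> \bar R}) (xi : T -> R) (K c : R) :
  measurable_fun setT xi -> 0 < K ->
  (\int[mu]_z (expR (`|xi z| / K))%:E <= c%:E)%E ->
  mu.-integrable setT (fun z => (expR (`|xi z| / K))%:E).
Proof.
move=> mxi K0 Kc; apply/integrableP; split.
  apply/measurable_EFinP; apply: measurableT_comp => //.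
  by apply: measurable_funM => //; exact: measurableT_comp.
apply: le_lt_trans (ltry c); apply: le_trans Kc; apply: ge0_le_integral => //.
- apply: measurableT_comp => //; apply/measurable_EFinP; apply: measurableT_comp => //.
  by apply: measurable_funM => //; exact: measurableT_comp.
- apply/measurable_EFinP; apply: measurableT_comp => //.
  by apply: measurable_funM => //; exact: measurableT_comp.
- by move=> z _; rewrite /= ger0_norm// expR_ge0.
Qed.

Lemma exp_moment_integrable_id (d : measure_display) (T : measurableType d)
    (mu : {measure set T -> \bar R}) (xi : T -> R) (K c : R) :
  measurable_fun setT xi -> 0 < K ->
  (\int[mu]_z (expR (`|xi z| / K))%:E <= c%:E)%E ->
  mu.-integrable setT (EFin \o xi).
Proof.
move=> mxi K0 Kc; have eint := exp_moment_integrable mxi K0 Kc.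
apply: (le_integrable _ _ _ (integrableZl measurableT K eint)) => //.
  exact/measurable_EFinP.
move=> z _ /=; rewrite lee_fin [leRHS]ger0_norm; last first.
  by rewrite mulr_ge0 ?expR_ge0// ltW.
rewrite mulrC -ler_pdivrMr//; have := expR_ge1Dx (`|xi z| / K); lra.
Qed.

(** Since xi has mean zero, the linear term of [expR_le_quadratic] disappears;
    for |lam| <= 1 / (2 K) the remainder (lam xi)^2 exp |lam xi| is at most
    16 lam^2 K^2 exp (|xi| / K), half of the exponent absorbing the square. *)
Lemma mgf_le (d : measure_display) (T : measurableType d)
    (mu : probability T R) (xi : T -> R) (K c lam : R) :
  measurable_fun setT xi -> 0 < K ->
  (\int[mu]_z (expR (`|xi z| / K))%:E <= c%:E)%E ->
  (\int[mu]_z (xi z)%:E = 0)%E -> `|lam| <= (2 * K)^-1 ->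
  (\int[mu]_z (expR (lam * xi z))%:E <=
    (expR (16 * c * K ^+ 2 * lam ^+ 2))%:E)%E.
Proof.
move=> mxi K0 Kc xi0 lamK.
have eint := exp_moment_integrable mxi K0 Kc.
have iint := exp_moment_integrable_id mxi K0 Kc.
have lam_xi z : `|lam * xi z| <= `|xi z| / K / 2.
  by rewrite normrM mulrC -mulrA ler_wpM2l// -invfM mulrC.
pose D := 16 * K ^+ 2 * lam ^+ 2.
have D0 : 0 <= D by rewrite /D; nra.
have mlam : measurable_fun setT (fun z => expR (lam * xi z)).
  by apply: measurableT_comp => //; exact: measurable_funM.
have lint : mu.-integrable setT (fun z => (expR (lam * xi z))%:E).
  apply: (le_integrable _ _ _ eint) => //; first exact/measurable_EFinP.
  move=> z _ /=; rewrite lee_fin !(ger0_norm (expR_ge0 _)) ler_expR.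
  apply: le_trans (ler_norm _) _; apply: le_trans (lam_xi z) _.
  by have : 0 <= `|xi z| / K by [rewrite divr_ge0// ltW]; lra.
have i1 : mu.-integrable setT (EFin \o cst (1 : R)).
  exact: finite_measure_integrable_cst.
have i2 := integrableZl measurableT lam iint.
have i3 := integrableZl measurableT D eint.
have i12 := integrableD measurableT i1 i2.
have rint := integrableD measurableT i12 i3.
apply: (@le_trans _ _ (1 + D * c)%:E); last first.
  rewrite lee_fin (_ : 16 * _ * _ * _ = D * c); last by rewrite /D; lra.
  exact: expR_ge1Dx.
apply: le_trans (le_integral measurableT lint rint _) _.
  move=> z _ /=; rewrite lee_fin.
  apply: le_trans (expR_le_quadratic _) _; rewrite lerD2l.
  set u := `|xi z| / K.
  have u0 : 0 <= u by rewrite divr_ge0// ltW.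
  have -> : (lam * xi z) ^+ 2 = lam ^+ 2 * K ^+ 2 * u ^+ 2.
    by rewrite /u exprMn -[in LHS](real_normK (num_real (xi z))); field; lra.
  rewrite -mulrA (_ : D = lam ^+ 2 * K ^+ 2 * 16); last by rewrite /D; lra.
  rewrite -[leRHS]mulrA ler_wpM2l//; first by rewrite mulr_ge0 ?sqr_ge0.
  apply: (@le_trans _ _ (16 * expR (u / 2) * expR (u / 2))).
    apply: ler_pM; rewrite ?sqr_ge0 ?expR_ge0 ?sqr_le_expR// ler_expR.
    exact: lam_xi.
  by rewrite -mulrA -expRD (_ : u / 2 + u / 2 = u)//; lra.
rewrite /= integralD//= integralD//= integral_cst//= probability_setT mule1.
rewrite !integralZl//= xi0 mule0 adde0 EFinD leeD2l// [leRHS]EFinM.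
by rewrite lee_wpmul2l// lee_fin.
Qed.

End exponential_moments.

Section distribution_class.
Context (R : realType).

Lemma measurable_tnth_prod (p : nat) (j k : 'I_p.+1) :
  measurable_fun setT (fun z : p.+1.-tuple R => tnth z j * tnth z k).
Proof. by apply: measurable_funM; exact: measurable_tnth. Qed.

Lemma measurable_centered_product (p : nat)
    (mu : probability (p.+1.-tuple R) R) (j k : 'I_p.+1) :
  measurable_fun setT (centered_product mu j k).
Proof. by apply: measurable_funB => //; exact: measurable_tnth_prod. Qed.

(** A psi_r bound with r >= 1 is used only through the psi_1 tail that it
    implies, by x <= 1 + x^r. *)
Lemma orlicz_exp_moment (d : measure_display) (T : measurableType d)
    (mu : probability T R) (xi : T -> R) (r C K : R) :
  measurable_fun setT xi -> 1 <= r -> C < K ->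
  (orlicz_norm mu (psi_exp r) xi <= C%:E)%E ->
  (\int[mu]_z (expR (`|xi z| / K))%:E <= (2 * expR 1)%:E)%E.
Proof.
move=> mxi r1 CK xiC.
have /ereal_inf_lt[_ [c [c0 cE] <-]] : (orlicz_norm mu (psi_exp r) xi < K%:E)%E.
  by apply: le_lt_trans xiC _; rewrite lte_fin.
rewrite lte_fin => cK.
have K0 : 0 < K by exact: lt_trans cK.
have mE (a : R) : measurable_fun setT (fun z => `|xi z| / a).
  by apply: measurable_funM => //; exact: measurableT_comp.
have mpsi : measurable_fun setT (fun z => psi_exp r (`|xi z| / c)).
  apply: measurable_funB => //; apply: (measurableT_comp (@measurable_expR R)).
  exact: (measurableT_comp (measurable_powR r) (mE c)).
have psi0 z : 0 <= psi_exp r (`|xi z| / c).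
  by rewrite /psi_exp subr_ge0 -expR0 ler_expR powR_ge0.
have i1 : mu.-integrable setT (EFin \o cst (1 : R)).
  exact: finite_measure_integrable_cst.
apply: (@le_trans _ _
    (\int[mu]_z ((expR 1)%:E * ((psi_exp r (`|xi z| / c))%:E + 1%:E)))%E).
  apply: ge0_le_integral => //.
  - by apply/measurable_EFinP; exact: measurableT_comp.
  - by apply: measurable_funeM; apply: emeasurable_funD => //; exact/measurable_EFinP.
  move=> z _; rewrite -EFinD -EFinM lee_fin /psi_exp subrK -expRD ler_expR.
  apply: le_trans (powR_ge_id _ r1); last by rewrite divr_ge0// ltW.
  by rewrite ler_wpM2l// lef_pV2// ?posrE// ltW.
rewrite ge0_integralZl//; last 2 first.
- by apply: emeasurable_funD => //; exact/measurable_EFinP.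
- by move=> z _; rewrite adde_ge0// lee_fin.
rewrite ge0_integralD//; last 2 first.
- by move=> z _; rewrite lee_fin.
- exact/measurable_EFinP.
rewrite integral_cst//= probability_setT mule1 mulrC EFinM.
rewrite lee_wpmul2l ?lee_fin ?expR_ge0//.
move: cE; rewrite unlock => cE.
by rewrite (_ : 2%:E = 1 + 1)%E ?leeD// -EFinD.
Qed.

Lemma bounded_exp_moment (p : nat) (mu : probability (p.+1.-tuple R) R)
    (C K : R) (j k : 'I_p.+1) :
  (forall j : 'I_p.+1, {ae mu, forall z, `|tnth z j| <= C}) ->
  0 <= C -> 2 * C ^+ 2 < K ->
  (\int[mu]_z (expR (`|centered_product mu j k z| / K))%:E <=
    (2 * expR 1)%:E)%E.
Proof.
move=> zC C0 CK.
have K0 : 0 < K by apply: le_lt_trans CK; nra.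
have zzC : {ae mu, forall z, setT z -> (`|(tnth z j * tnth z k)%:E| <= (C ^+ 2)%:E)%E}.
  move: (zC j) (zC k); apply: filterS2 => z zj zk _.
  by rewrite /= lee_fin normrM expr2 ler_pM.
have mzz := @measurable_tnth_prod p j k.
have mom : `|fine ('E_mu[fun z => (tnth z j * tnth z k)%R])%E| <= C ^+ 2.
  have : (`|'E_mu[fun z => (tnth z j * tnth z k)%R]| <= (C ^+ 2)%:E)%E.
    rewrite unlock; apply: le_trans (le_abse_integral _ _ _) _ => //.
      exact/measurable_EFinP.
    apply: (@le_trans _ _ (\int[mu]_z (C ^+ 2)%:E)%E).
      apply: ae_ge0_le_integral => //.
      - by apply: measurableT_comp => //; exact/measurable_EFinP.
      - by move=> z _; rewrite lee_fin sqr_ge0.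
    by rewrite integral_cst//= probability_setT mule1.
  case: ('E_mu[_])%E => [x| |] //=; rewrite normr0 sqr_ge0//.
apply: (@le_trans _ _ (\int[mu]_z (2 * expR 1)%:E)%E); last first.
  by rewrite integral_cst//= probability_setT mule1.
have mE : measurable_fun setT (fun z => expR (`|centered_product mu j k z| / K)).
  apply: measurableT_comp => //; apply: measurable_funM => //.
  by apply: measurableT_comp => //; exact: measurable_centered_product.
apply: ae_ge0_le_integral => //.
  exact/measurable_EFinP.
move: zzC; apply: filterS => z /(_ I); rewrite /= !lee_fin => zC2 _.
apply: (@le_trans _ _ (expR 1)); last by have := expR_gt0 (1 : R); lra.
rewrite ler_expR ler_pdivrMr// mul1r.
apply: le_trans (ler_normB _ _) _; lra.
Qed.

(** The single consequence of membership in the class used for concentration: K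
    does not depend on n, on the coordinates, or on whether q is finite. *)
Lemma in_class_exp_moment (q : \bar R) (p : nat -> nat)
    (mu : forall n, probability ((p n).+1.-tuple R) R) :
  (1 <= q)%E -> in_class q mu ->
  exists2 K : R, 0 < K & forall n (j k : 'I_(p n).+1),
    (\int[mu n]_z (expR (`|centered_product (mu n) j k z| / K))%:E <=
      (2 * expR 1)%:E)%E.
Proof.
case: q => [r| |] // q1 [C muC].
  exists (`|C| + 1); first by rewrite ltr_wpDl.
  move=> n j k; apply: (orlicz_exp_moment _ _ _ (muC n j k)).
  - exact: measurable_centered_product.
  - by rewrite -lee_fin.
  - by rewrite (le_lt_trans (ler_norm _))// ltrDl.
exists (2 * `|C| ^+ 2 + 1); first by rewrite ltr_wpDl// mulr_ge0// sqr_ge0.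
move=> n j k; apply: (@bounded_exp_moment _ _ `|C|) => //; last by rewrite ltrDl.
move=> i; move: (muC n i); apply: filterS => z zC.
exact: le_trans zC (ler_norm _).
Qed.

Lemma in_class_response (q : \bar R) (p : nat -> nat)
    (mu : forall n, probability ((p n).+1.-tuple R) R) :
  (1 <= q)%E -> in_class q mu ->
  ((q < +oo)%E -> exists M : R, \forall n \near \oo,
    ('E_(mu n)[fun z => (response z ^+ 2)%R] <= M%:E)%E) ->
  exists M : R, \forall n \near \oo,
    ('E_(mu n)[fun z => (response z ^+ 2)%R] <= M%:E)%E.
Proof.
case: q => [r| |] // q1 [C muC]; first by apply; exact: ltry.
move=> _; exists (C ^+ 2); apply: nearW => n; rewrite unlock.
apply: (@le_trans _ _ (\int[mu n]_z (C ^+ 2)%:E)%E); last first.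
  by rewrite integral_cst//= probability_setT mule1.
apply: ae_ge0_le_integral => //.
- by move=> z _; rewrite lee_fin sqr_ge0.
- by apply/measurable_EFinP; exact: measurable_tnth_prod.
- by move=> z _; rewrite lee_fin sqr_ge0.
move: (muC n ord0); apply: filterS => z zC _.
rewrite lee_fin -[leLHS](real_normK (num_real _)).
by rewrite lerXn2r// ?nnegrE// (le_trans _ zC).
Qed.

End distribution_class.

(** * Concentration of empirical second moments *)

Section moment_errors.
Context (R : realType).

Definition moment_deviation (p n : nat) (mu : probability (p.+1.-tuple R) R)
    (z : 'I_n -> p.+1.-tuple R) (A : {set 'I_n}) (jk : 'I_p.+1 * 'I_p.+1) : R :=
  #|A|%:R^-1 * \sum_(i in A) centered_product mu jk.1 jk.2 (z i).

Definition moment_error (p n : nat) (mu : probability (p.+1.-tuple R) R)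
    (z : 'I_n -> p.+1.-tuple R) (A : {set 'I_n}) : R :=
  \big[Order.max/0]_jk `|moment_deviation mu z A jk|.

(** A smooth substitute for exp (nu err_A): it dominates that exponential, and
    its expectation is the sum of (p + 1)^2 pairs of moment generating
    functions. *)
Definition exp_deviation (p n : nat) (mu : probability (p.+1.-tuple R) R)
    (nu : R) (z : 'I_n -> p.+1.-tuple R) (A : {set 'I_n}) : R :=
  \sum_jk (expR (nu * moment_deviation mu z A jk) +
           expR (- nu * moment_deviation mu z A jk)).

Definition cv_error (p n : nat) (mu : probability (p.+1.-tuple R) R)
    (V : {set {set 'I_n}}) (z : 'I_n -> p.+1.-tuple R) : R :=
  #|V|%:R^-1 * \sum_(v in V) (moment_error mu z [set: 'I_n]%SET +
    moment_error mu z v + moment_error mu z (~: v)%SET).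

Lemma moment_error_ge0 (p n : nat) (mu : probability (p.+1.-tuple R) R)
    (z : 'I_n -> p.+1.-tuple R) (A : {set 'I_n}) : 0 <= moment_error mu z A.
Proof.
by apply: (big_ind (fun x : R => 0 <= x)) => // x y x0 y0; rewrite le_max x0.
Qed.

Lemma moment_deviation_le (p n : nat) (mu : probability (p.+1.-tuple R) R)
    (z : 'I_n -> p.+1.-tuple R) (A : {set 'I_n}) (j k : 'I_p.+1) :
  `|moment_deviation mu z A (j, k)| <= moment_error mu z A.
Proof. exact: (le_bigmax_cond 0 (fun jk => `|moment_deviation mu z A jk|)). Qed.

Lemma expR_moment_error (p n : nat) (mu : probability (p.+1.-tuple R) R)
    (nu : R) (z : 'I_n -> p.+1.-tuple R) (A : {set 'I_n}) :
  0 <= nu -> expR (nu * moment_error mu z A) <= exp_deviation mu nu z A.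
Proof.
move=> nu0.
have term_ge0 jk : 0 <= expR (nu * moment_deviation mu z A jk) +
    expR (- nu * moment_deviation mu z A jk) by rewrite addr_ge0// expR_ge0.
have le_term jk : expR (nu * moment_deviation mu z A jk) +
    expR (- nu * moment_deviation mu z A jk) <= exp_deviation mu nu z A.
  by rewrite /exp_deviation (bigD1 jk)//= lerDl sumr_ge0.
have abs_le jk :
    expR (nu * `|moment_deviation mu z A jk|) <= exp_deviation mu nu z A.
  apply: le_trans (le_term jk).
  set x := moment_deviation _ _ _ _; have := expR_ge0 (nu * x).
  have := expR_ge0 (- nu * x); have [x0|x0] := ger0P x; first lra.
  rewrite mulNr -mulrN; lra.
apply: (big_ind (fun x => expR (nu * x) <= exp_deviation mu nu z A)) => //.
- apply: le_trans (abs_le (ord0, ord0)); rewrite ler_expR mulr0.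
  exact: mulr_ge0.
- by move=> x y; case: (leP x y).
Qed.

Lemma measurable_moment_deviation (d : measure_display)
    (Omega : measurableType d) (P : probability Omega R) (p n : nat)
    (mu : probability (p.+1.-tuple R) R) (Z : 'I_n -> {RV P >-> p.+1.-tuple R})
    (A : {set 'I_n}) (jk : 'I_p.+1 * 'I_p.+1) :
  measurable_fun setT (fun w => moment_deviation mu (fun i => Z i w) A jk).
Proof.
apply: measurable_funM => //; under eq_fun do rewrite -big_filter.
apply: measurable_sum => i.
exact: (measurableT_comp (measurable_centered_product mu _ _)).
Qed.

Lemma measurable_exp_deviation (d : measure_display) (Omega : measurableType d)
    (P : probability Omega R) (p n : nat) (mu : probability (p.+1.-tuple R) R)
    (nu : R) (Z : 'I_n -> {RV P >-> p.+1.-tuple R}) (A : {set 'I_n}) :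
  measurable_fun setT (fun w => exp_deviation mu nu (fun i => Z i w) A).
Proof.
have mdev := measurable_moment_deviation mu Z A.
by apply: measurable_sum => jk; apply: measurable_funD;
  apply: measurableT_comp => //; exact: measurable_funM.
Qed.

Lemma expectation_exp_sample (d : measure_display) (Omega : measurableType d)
    (P : probability Omega R) (d' : measure_display) (T : measurableType d')
    (mu : probability T R) (n : nat) (Z : 'I_n -> {RV P >-> T})
    (A : {set 'I_n}) (xi : T -> R) (lam g : R) :
  iid_sample mu Z -> measurable_fun setT xi ->
  (\int[mu]_z (expR (lam * xi z))%:E <= (expR g)%:E)%E ->
  (\int[P]_w (expR (lam * \sum_(i in A) xi (Z i w)))%:E <=
    (expR (g *+ #|A|))%:E)%E.
Proof.
move=> iidZ mxi mgf.
have mgf0 : (0 <= \int[mu]_z (expR (lam * xi z))%:E)%E.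
  by apply: integral_ge0 => z _; rewrite lee_fin expR_ge0.
pose e := fine (\int[mu]_z (expR (lam * xi z))%:E)%E.
have eE : (\int[mu]_z (expR (lam * xi z))%:E = e%:E)%E.
  rewrite fineK// ge0_fin_numE//; apply: le_lt_trans mgf _; exact: ltry.
pose h i z := if i \in A then expR (lam * xi z) else 1.
pose e' (i : 'I_n) := if i \in A then e else 1.
have := @iid_expectation_prod R _ _ _ _ P mu n Z h e' iidZ.
have -> : (fun w => (\prod_(i < n) h i (Z i w))%:E) =
    (fun w => (expR (lam * \sum_(i in A) xi (Z i w)))%:E).
  by apply/funext => w; rewrite mulr_sumr expR_sum [in RHS]big_mkcond.
move=> ->.
- rewrite lee_fin /e' -big_mkcond prodr_const -mulr_natr expRM_natr lerXn2r// ?nnegrE ?expR_ge0//.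
    by rewrite -lee_fin -eE.
  by rewrite -lee_fin -eE.
- move=> i; rewrite /h; case: (i \in A) => //.
  by apply: measurableT_comp => //; exact: measurable_funM.
- by move=> i z; rewrite /h; case: ifP; rewrite ?expR_ge0.
- move=> i; rewrite /h /e'; case: (i \in A) => //.
  by rewrite integral_cst//= probability_setT mule1.
Qed.

Lemma expectation_exp_deviation (d : measure_display) (Omega : measurableType d)
    (P : probability Omega R) (p n : nat) (mu : probability (p.+1.-tuple R) R)
    (Z : 'I_n -> {RV P >-> p.+1.-tuple R}) (A : {set 'I_n}) (K nu N : R) :
  iid_sample mu Z -> 0 < K ->
  (forall j k, \int[mu]_z (expR (`|centered_product mu j k z| / K))%:E <=
      (2 * expR 1)%:E)%E ->
  (forall j k, \int[mu]_z (centered_product mu j k z)%:E = 0)%E ->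
  0 < N -> N <= #|A|%:R -> 0 <= nu -> nu / N <= (2 * K)^-1 ->
  (\int[P]_w (exp_deviation mu nu (fun i => Z i w) A)%:E <=
    (2 * p.+1%:R ^+ 2 *
      expR (16 * (2 * expR 1) * K ^+ 2 * (nu ^+ 2 / N)))%:E)%E.
Proof.
move=> iidZ K0 momK mom0 N0 NA nu0 nuK.
have A0 : 0 < #|A|%:R :> R by exact: lt_le_trans NA.
set D := 16 * _ * _.
have D0 : 0 <= D by rewrite /D !mulr_ge0// ?expR_ge0// ltW.
have mdev (c : R) jk : measurable_fun setT
    (fun w => expR (c * moment_deviation mu (fun i => Z i w) A jk)).
  apply: measurableT_comp => //; apply: measurable_funM => //.
  exact: measurable_moment_deviation.
have one (c : R) jk : `|c| = nu ->
    (\int[P]_w (expR (c * moment_deviation mu (fun i => Z i w) A jk))%:E <=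
      (expR (D * (nu ^+ 2 / N)))%:E)%E.
  move=> cnu.
  have cA : `|c / #|A|%:R| <= (2 * K)^-1.
    rewrite normrM cnu normfV (ger0_norm (ltW A0)); apply: le_trans nuK.
    by rewrite ler_wpM2l// lef_pV2 ?posrE.
  have := mgf_le (measurable_centered_product mu jk.1 jk.2) K0 (momK _ _) (mom0 _ _) cA.
  move=> /(expectation_exp_sample A iidZ (measurable_centered_product mu jk.1 jk.2)).
  under eq_integral do rewrite -mulrA.
  move=> /le_trans; apply; rewrite lee_fin ler_expR -/D -mulrnAr ler_wpM2l//.
  rewrite -mulr_natr exprMn -cnu real_normK ?num_real// -mulrA ler_wpM2l ?sqr_ge0//.
  by rewrite expr2 -mulrA mulVf ?gt_eqF// mulr1 lef_pV2 ?posrE.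
rewrite /exp_deviation; under eq_integral do rewrite -sumEFin.
rewrite ge0_integral_sum//; last first.
  by move=> jk; apply/measurable_EFinP; exact: measurable_funD.
apply: (@le_trans _ _ (\sum_(jk : 'I_p.+1 * 'I_p.+1)
   (2 * expR (D * (nu ^+ 2 / N)))%:E)%E).
  apply: lee_sum => jk _; under eq_integral do rewrite EFinD.
  rewrite ge0_integralD//; last 2 first.
  - exact/measurable_EFinP.
  - exact/measurable_EFinP.
  rewrite mulr2n mulrDl mul1r EFinD leeD// one//.
    by rewrite ger0_norm.
  by rewrite normrN ger0_norm.
rewrite sumEFin sumr_const card_prod !card_ord lee_fin -[leLHS]mulr_natr natrM.
by rewrite le_eqVlt; apply/orP; left; apply/eqP; ring.
Qed.

(** Markov's inequality, for an event that need not be measurable. *)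
Lemma outer_probability_le (d : measure_display) (Omega : measurableType d)
    (P : probability Omega R) (E : set Omega) (phi : Omega -> R) :
  measurable_fun setT phi -> (forall w, 0 <= phi w) ->
  (forall w, E w -> 1 <= phi w) ->
  (outer_probability P E <= \int[P]_w (phi w)%:E)%E.
Proof.
move=> mphi phi0 Ephi; pose B := [set w | 1 <= phi w].
have mB : measurable B.
  rewrite (_ : B = phi @^-1` `[1, +oo[%classic); last first.
    by apply/seteqP; split => w; rewrite /B/= in_itv/= andbT.
  by rewrite -[X in measurable X]setTI; exact: mphi.
apply: (@le_trans _ _ (P B)).
  by rewrite -measurable_mu_extE//; apply: le_mu_ext => w /Ephi.
rewrite -[X in P X]setIT -integral_indic//; apply: ge0_le_integral => //.
- exact/measurable_EFinP.
- exact/measurable_EFinP.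
move=> w _; rewrite lee_fin indicE; have [/set_mem//|_] := boolP (w \in B).
exact: phi0.
Qed.

(** By exp x >= 1 + x, if the average over v of the sum of the three errors is
    above 3 s then the average of exp (nu (err_A - s)) over the same index sets
    A is at least 1.  Taking expectations in this average keeps the size of V
    out of the bound. *)
Lemma cv_error_tail (d : measure_display) (Omega : measurableType d)
    (P : probability Omega R) (p n : nat) (mu : probability (p.+1.-tuple R) R)
    (Z : 'I_n -> {RV P >-> p.+1.-tuple R}) (V : {set {set 'I_n}})
    (K nu N s : R) :
  iid_sample mu Z -> 0 < K ->
  (forall j k, \int[mu]_z (expR (`|centered_product mu j k z| / K))%:E <=
      (2 * expR 1)%:E)%E ->
  (forall j k, \int[mu]_z (centered_product mu j k z)%:E = 0)%E ->
  V != finset.set0 -> 0 < N -> N <= n%:R ->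
  (forall v, v \in V -> N <= #|v|%:R /\ N <= #|(~: v)%SET|%:R) ->
  0 < nu -> nu / N <= (2 * K)^-1 ->
  (outer_probability P [set w | (3 * s < cv_error mu V (fun i => Z i w))%R] <=
    (2 * p.+1%:R ^+ 2 *
      expR (16 * (2 * expR 1) * K ^+ 2 * (nu ^+ 2 / N) - nu * s))%:E)%E.
Proof.
move=> iidZ K0 momK mom0 V0 N0 Nn NV nu0 nuK.
have cV0 : 0 < #|V|%:R :> R by rewrite ltr0n card_gt0.
pose F w A := exp_deviation mu nu (fun i => Z i w) A.
have F_ge0 w A : 0 <= F w A.
  by apply: sumr_ge0 => jk _; rewrite addr_ge0// expR_ge0.
have mF A : measurable_fun setT (F ^~ A) by exact: measurable_exp_deviation.
pose c := expR (- (nu * s)) / (3 * #|V|%:R).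
have c0 : 0 <= c by rewrite divr_ge0 ?expR_ge0// mulr_ge0.
pose phi w := c * \sum_(v in V) (F w [set: 'I_n]%SET + F w v + F w (~: v)%SET).
have mG v : measurable_fun setT
    (fun w => F w [set: 'I_n]%SET + F w v + F w (~: v)%SET).
  by apply: measurable_funD => //; exact: measurable_funD.
have G0 v w : 0 <= F w [set: 'I_n]%SET + F w v + F w (~: v)%SET.
  by rewrite !addr_ge0.
apply: le_trans (@outer_probability_le _ _ P _ phi _ _ _) _.
- apply: measurable_funM => //; under eq_fun do rewrite -big_filter.
  exact: measurable_sum.
- by move=> w; rewrite mulr_ge0// sumr_ge0.
- move=> w /= scv.
  (* The tangent line of exp at 0 bounds the errors by exponentials. *)
  have lin (A : {set 'I_n}) : 1 + nu * (moment_error mu (fun i => Z i w) A - s) <=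
      expR (- (nu * s)) * F w A.
    apply: le_trans (expR_ge1Dx _) _; rewrite mulrBr addrC expRD.
    by rewrite ler_wpM2l ?expR_ge0// expR_moment_error// ltW.
  pose err := moment_error mu (fun i => Z i w).
  have -> : phi w = (3 * #|V|%:R)^-1 * \sum_(v in V) (expR (- (nu * s)) * F w [set: 'I_n]%SET +
      expR (- (nu * s)) * F w v + expR (- (nu * s)) * F w (~: v)%SET).
    rewrite /phi /c [expR _ / _]mulrC -mulrA mulr_sumr; congr (_ * _).
    by apply: eq_bigr => v _; rewrite !mulrDr.
  rewrite ler_pdivlMl ?mulr_gt0// mulr1.
  apply: (@le_trans _ _ (\sum_(v in V) (3 + nu * ((err [set: 'I_n]%SET + err v +
      err (~: v)%SET) - 3 * s)))); last first.
    apply: ler_sum => v _.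
    have := lin [set: 'I_n]%SET; have := lin v; have := lin (~: v)%SET.
    rewrite -/err; lra.
  rewrite big_split/= sumr_const -(mulr_natr (3 : R)) lerDl -mulr_sumr mulr_ge0 ?(ltW nu0)//.
  rewrite sumrB sumr_const -(mulr_natr (3 * s)) subr_ge0 -ler_pdivlMr//.
  by rewrite [leRHS]mulrC ltW.
set D := 16 * _ * _.
have intF (A : {set 'I_n}) : N <= #|A|%:R -> (\int[P]_w (F w A)%:E <=
    (2 * p.+1%:R ^+ 2 * expR (D * (nu ^+ 2 / N)))%:E)%E.
  by move=> NA; apply: expectation_exp_deviation => //; exact: ltW.
rewrite /phi; under eq_integral do rewrite EFinM -sumEFin -big_filter.
rewrite ge0_integralZl//; last 2 first.
- apply: emeasurable_sum => v; exact/measurable_EFinP.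
- by move=> w _; rewrite sume_ge0// => v _; rewrite lee_fin.
rewrite ge0_integral_sum//; last 2 first.
- by move=> v; exact/measurable_EFinP.
- by move=> v w _; rewrite lee_fin.
rewrite big_filter.
set E := 2 * _ * expR _ in intF.
apply: (@le_trans _ _ (c%:E * (\sum_(v in V) (3 * E)%:E))%E); last first.
  rewrite sumEFin -EFinM lee_fin sumr_const -(mulr_natr (3 * E)) expRD /c /E.
  rewrite le_eqVlt; apply/orP; left; apply/eqP; field.
  by rewrite gt_eqF.
rewrite lee_wpmul2l ?lee_fin//; apply: lee_sum => v vV.
under eq_integral do rewrite !EFinD.
rewrite ge0_integralD//; last 4 first.
- by move=> w _; rewrite -EFinD lee_fin addr_ge0.
- by apply: emeasurable_funD; exact/measurable_EFinP.
- by move=> w _; rewrite lee_fin.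
- exact/measurable_EFinP.
rewrite ge0_integralD//; last 4 first.
- by move=> w _; rewrite lee_fin.
- exact/measurable_EFinP.
- by move=> w _; rewrite lee_fin.
- exact/measurable_EFinP.
rewrite (_ : 3 * E = E + E + E); last lra.
have [Nv Nvc] := NV v vV.
by rewrite !EFinD !leeD// intF// cardsT card_ord.
Qed.

End moment_errors.

(** * Empirical risk and the oracle inequality *)

Section empirical_risk.
Context (R : realType).

Definition emp_risk (n p : nat) (z : 'I_n -> p.+1.-tuple R) (A : {set 'I_n})
    (beta : 'cV[R]_p) : R :=
  #|A|%:R^-1 * \sum_(i in A) residual (z i) beta ^+ 2.

(** The vector (1, - beta), whose product with z is the residual. *)
Definition contrast (p : nat) (beta : 'cV[R]_p) (i : 'I_p.+1) : R :=
  if unlift ord0 i is Some j then - beta j ord0 else 1.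

Definition contrast2 (p : nat) (beta : 'cV[R]_p) (jk : 'I_p.+1 * 'I_p.+1) : R :=
  contrast beta jk.1 * contrast beta jk.2.

Lemma residualE (p : nat) (z : p.+1.-tuple R) (beta : 'cV[R]_p) :
  residual z beta = \sum_i contrast beta i * tnth z i.
Proof.
rewrite big_ord_recl /contrast unlift_none mul1r /residual; congr (_ + _).
rewrite -sumrN; apply: eq_bigr => j _.
by rewrite liftK mulNr tnth_mktuple mulrC.
Qed.

Lemma residual_sqrE (p : nat) (z : p.+1.-tuple R) (beta : 'cV[R]_p) :
  residual z beta ^+ 2 =
  \sum_jk contrast2 beta jk * (tnth z jk.1 * tnth z jk.2).
Proof.
rewrite residualE expr2 big_distrl/= -(pair_bigA _ (fun j k =>
  contrast2 beta (j, k) * (tnth z j * tnth z k)))/=.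
apply: eq_bigr => j _; rewrite big_distrr/=; apply: eq_bigr => k _.
by rewrite /contrast2/=; ring.
Qed.

Lemma sum_norm_contrast2 (p : nat) (beta : 'cV[R]_p) :
  \sum_jk `|contrast2 beta jk| = (1 + \sum_(j < p) `|beta j ord0|) ^+ 2.
Proof.
have -> : 1 + \sum_(j < p) `|beta j ord0| = \sum_i `|contrast beta i|.
  rewrite big_ord_recl /contrast unlift_none normr1; congr (_ + _).
  by apply: eq_bigr => j _; rewrite liftK normrN.
rewrite expr2 big_distrl/= -(pair_bigA _ (fun j k => `|contrast2 beta (j, k)|))/=.
apply: eq_bigr => j _; rewrite big_distrr/=; apply: eq_bigr => k _.
by rewrite /contrast2/= normrM.
Qed.

Section moments.
Context (p : nat) (mu : probability (p.+1.-tuple R) R) (K c : R).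
Hypothesis K0 : 0 < K.
Hypothesis momK : forall j k : 'I_p.+1,
  (\int[mu]_z (expR (`|centered_product mu j k z| / K))%:E <= c%:E)%E.

Let moment (j k : 'I_p.+1) : R :=
  fine ('E_mu[fun z => (tnth z j * tnth z k)%R])%E.

Lemma integrable_product j k :
  mu.-integrable setT (EFin \o (fun z : p.+1.-tuple R => tnth z j * tnth z k)).
Proof.
have i1 := exp_moment_integrable_id (measurable_centered_product mu j k) K0 (momK j k).
have i2 : mu.-integrable setT (EFin \o cst (moment j k)).
  exact: finite_measure_integrable_cst.
apply: eq_integrable (integrableD measurableT i1 i2) => //.
by move=> z _ /=; rewrite -EFinD /centered_product subrK.
Qed.

Lemma integral_product j k :
  (\int[mu]_z (tnth z j * tnth z k)%:E = (moment j k)%:E)%E.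
Proof.
rewrite /moment unlock fineK//; exact: integrable_fin_num (integrable_product j k).
Qed.

Lemma integral_centered_product j k :
  (\int[mu]_z (centered_product mu j k z)%:E = 0)%E.
Proof.
have i2 : mu.-integrable setT (EFin \o cst (moment j k)).
  exact: finite_measure_integrable_cst.
under eq_integral do rewrite EFinB.
rewrite integralB//=; last exact: integrable_product.
by rewrite integral_product integral_cst//= probability_setT mule1 subee.
Qed.

Lemma risk_quadratic (beta : 'cV[R]_p) :
  risk mu beta = \sum_jk contrast2 beta jk * moment jk.1 jk.2.
Proof.
rewrite /risk unlock.
under eq_integral do rewrite residual_sqrE -sumEFin.
rewrite integral_sum//=; last first.
  move=> jk; under eq_fun do rewrite EFinM.
  exact: integrableZl (integrable_product _ _).
rewrite (eq_bigr (fun jk => (contrast2 beta jk * moment jk.1 jk.2)%:E)).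
  by rewrite sumEFin.
move=> jk _; under eq_integral do rewrite EFinM.
by rewrite integralZl// ?integral_product//; exact: integrable_product.
Qed.

(** The risk and the empirical risk are the same quadratic form, one in the
    population moments and the other in the empirical ones. *)
Lemma emp_risk_deviation (n : nat) (z : 'I_n -> p.+1.-tuple R) (A : {set 'I_n})
    (beta : 'cV[R]_p) :
  (0 < #|A|)%N ->
  emp_risk z A beta - risk mu beta =
  \sum_jk contrast2 beta jk * moment_deviation mu z A jk.
Proof.
move=> A0; rewrite risk_quadratic.
have -> : emp_risk z A beta = \sum_jk contrast2 beta jk *
    (#|A|%:R^-1 * \sum_(i in A) tnth (z i) jk.1 * tnth (z i) jk.2).
  rewrite /emp_risk; under eq_bigr do rewrite residual_sqrE.
  rewrite exchange_big/= mulr_sumr; apply: eq_bigr => jk _.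
  by rewrite -mulr_sumr mulrCA.
rewrite -sumrB; apply: eq_bigr => jk _; rewrite -mulrBr; congr (_ * _).
rewrite /moment_deviation /centered_product -/(moment _ _) sumrB mulrBr.
congr (_ - _); rewrite sumr_const -(mulr_natr (moment _ _)) mulrCA mulVf ?mulr1//.
by rewrite pnatr_eq0 -lt0n.
Qed.

Lemma emp_risk_uniform (n : nat) (z : 'I_n -> p.+1.-tuple R) (A : {set 'I_n})
    (beta : 'cV[R]_p) (B : R) :
  (0 < #|A|)%N -> \sum_(j < p) `|beta j ord0| <= B ->
  `|emp_risk z A beta - risk mu beta| <= (1 + B) ^+ 2 * moment_error mu z A.
Proof.
move=> A0 bB; rewrite emp_risk_deviation//.
apply: le_trans (ler_norm_sum _ _ _) _.
apply: (@le_trans _ _ (\sum_jk `|contrast2 beta jk| * moment_error mu z A)).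
  apply: ler_sum => -[j k] _; rewrite normrM ler_wpM2l//.
  exact: moment_deviation_le.
rewrite -mulr_suml sum_norm_contrast2 ler_wpM2r ?moment_error_ge0//.
have l0 : 0 <= \sum_(j < p) `|beta j ord0| by exact: sumr_ge0.
by rewrite lerXn2r ?nnegrE//; lra.
Qed.

End moments.

(** Cauchy-Schwarz against the constant family, read off from the nonnegativity of
    the empirical variance. *)
Lemma sqr_sum_le (I : finType) (A : {set I}) (x : I -> R) :
  (\sum_(i in A) x i) ^+ 2 <= #|A|%:R * \sum_(i in A) x i ^+ 2.
Proof.
have [A0|A0] := posnP #|A|.
  have -> : A = finset.set0 by exact: cards0_eq.
  by rewrite !big_set0 expr0n mulr0.
have c0 : 0 < #|A|%:R :> R by rewrite ltr0n.
rewrite -(ler_pM2l c0) -subr_ge0.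
set c : R := #|A|%:R in c0 *; set S := \sum_(i in A) x i.
have : 0 <= \sum_(i in A) (c * x i - S) ^+ 2.
  by apply: sumr_ge0 => i _; exact: sqr_ge0.
rewrite (eq_bigr (fun i => c ^+ 2 * x i ^+ 2 - 2 * c * S * x i + S ^+ 2)); last first.
  by move=> i _; ring.
rewrite big_split/= sumr_const -(mulr_natr (S ^+ 2)) -/c sumrB -!mulr_sumr -/S.
by move=> h; apply: le_trans h _; rewrite le_eqVlt; apply/orP; left; apply/eqP; ring.
Qed.

(** The weights sqrt |g| are those for which the group penalty dominates the l1
    norm whatever the partition. *)
Lemma l1_le_penalty (k : lasso) (p : nat) (G : {set {set 'I_p}})
    (beta : 'cV[R]_p) :
  finset.partition G [set: 'I_p]%SET ->
  \sum_(j < p) `|beta j ord0| <= penalty k G beta.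
Proof.
case: k => // /and3P[/eqP covG trivG _] /=.
have -> : \sum_(j < p) `|beta j ord0| = \sum_(j in finset.cover G) `|beta j ord0|.
  by rewrite covG; apply: eq_bigl => j; rewrite inE.
rewrite finset.big_trivIset//=; apply: ler_sum => g _.
rewrite -sqrtrM ?ler0n// -[leLHS]ger0_norm ?sumr_ge0// -sqrtr_sqr.
apply: ler_wsqrtr; apply: le_trans (sqr_sum_le _ _) _.
rewrite ler_wpM2l//; apply: ler_sum => j _.
by rewrite real_normK ?num_real.
Qed.

Lemma penalty_ge0 (k : lasso) (p : nat) (G : {set {set 'I_p}})
    (beta : 'cV[R]_p) : 0 <= penalty k G beta.
Proof. by case: k; apply: sumr_ge0 => i _; rewrite ?mulr_ge0 ?sqrtr_ge0. Qed.

Lemma penalty0 (k : lasso) (p : nat) (G : {set {set 'I_p}}) :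
  penalty k G (0 : 'cV[R]_p) = 0.
Proof.
case: k => /=; rewrite big1// => g _; last by rewrite mxE normr0.
by rewrite big1 ?sqrtr0 ?mulr0// => j _; rewrite mxE expr0n.
Qed.

(** Both lassos minimize an increasing function of the residual sum of squares,
    hence the empirical risk itself. *)
Lemma estimate_emp_risk (k : lasso) (n p : nat) (G : {set {set 'I_p}})
    (z : 'I_n -> p.+1.-tuple R) (v : {set 'I_n}) (s : R)
    (bhat beta : 'cV[R]_p) :
  is_estimate k G z v s bhat -> penalty k G beta <= s ->
  emp_risk z (~: v)%SET bhat <= emp_risk z (~: v)%SET beta.
Proof.
case=> _ /(_ beta) opt /opt; rewrite /emp_risk /objective {opt}.
case: k => //; set A := (~: v)%SET.
have [A0|A0] := posnP #|A|; first by rewrite A0 invr0 !mul0r.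
have cA0 : 0 < #|A|%:R^-1 :> R by rewrite invr_gt0 ltr0n.
rewrite !ler_pM2l// ler_sqrt// sumr_ge0// => i _; exact: sqr_ge0.
Qed.

(** Write b_v(u) for the estimate without v at level u.  Up to
    errors, the risk of the selected estimator is at most that of b_v(that),
    since it wins on the whole sample; the latter is the validation risk of
    b_v(that), whose average over v is at most that of b_v(s); and the
    validation risk of b_v(s) is its risk on the complement of v, where it beats
    beta. *)
Lemma cv_oracle (k : lasso) (n p : nat) (mu : probability (p.+1.-tuple R) R)
    (K c : R) (G : {set {set 'I_p}}) (z : 'I_n -> p.+1.-tuple R)
    (V : {set {set 'I_n}}) (betahat : {set 'I_n} -> R -> 'cV[R]_p)
    (that tmax s B : R) (beta : 'cV[R]_p) :
  0 < K -> (forall j k : 'I_p.+1,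
    (\int[mu]_z (expR (`|centered_product mu j k z| / K))%:E <= c%:E)%E) ->
  finset.partition G [set: 'I_p]%SET -> V != finset.set0 -> (0 < n)%N ->
  (forall v, v \in V -> (0 < #|v|)%N /\ (0 < #|(~: v)%SET|)%N) ->
  (forall v s, 0 <= s -> is_estimate k G z v s (betahat v s)) ->
  is_argmin `[0, tmax] (cv_risk V z betahat) that ->
  0 <= s <= tmax -> penalty k G beta <= s -> tmax <= B ->
  risk mu (betahat finset.set0 that) - risk mu beta <=
    2 * (1 + B) ^+ 2 * cv_error mu V z.
Proof.
move=> K0 momK partG V0 n0 VP est [that_in that_min] s_in beta_s tB.
have /andP[s0 st] := s_in.
move: that_in; rewrite /= in_itv/= => /andP[h0 ht].
have cV0 : 0 < #|V|%:R :> R by rewrite ltr0n card_gt0.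
pose D A := (1 + B) ^+ 2 * moment_error mu z A.
have dev (A : {set 'I_n}) b : (0 < #|A|)%N -> penalty k G b <= B ->
    risk mu b - D A <= emp_risk z A b <= risk mu b + D A.
  move=> A0 bB; rewrite -ler_distl.
  by apply: (emp_risk_uniform K0 momK) => //; apply: le_trans (l1_le_penalty _ _ partG) bB.
have setC0E : (~: finset.set0)%SET = [set: 'I_n]%SET by rewrite finset.setC0.
have cT : (0 < #|[set: 'I_n]%SET|)%N by rewrite cardsT card_ord.
have pen_est v u : 0 <= u -> u <= tmax -> penalty k G (betahat v u) <= B.
  move=> u0 ut; apply: le_trans tB; apply: le_trans ut.
  by have [] := est v u u0.
pose bf := betahat finset.set0 that.
have step1 v : v \in V ->
    risk mu bf <= emp_risk z v (betahat v that) + (2 * D [set: 'I_n]%SET + D v).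
  move=> vV; have [v0 _] := VP v vV.
  have /andP[d1 _] := dev _ bf cT (pen_est _ _ h0 ht).
  have /andP[_ d2] := dev _ (betahat v that) cT (pen_est _ _ h0 ht).
  have /andP[d3 _] := dev _ (betahat v that) v0 (pen_est _ _ h0 ht).
  have := @estimate_emp_risk k n p G z finset.set0 that bf (betahat v that) (est _ _ h0).
  rewrite setC0E => /(_ (proj1 (est v that h0))).
  lra.
have step2 v : v \in V ->
    emp_risk z v (betahat v s) <= risk mu beta + (D v + 2 * D (~: v)%SET).
  move=> vV; have [v0 vc0] := VP v vV.
  have /andP[_ d1] := dev _ (betahat v s) v0 (pen_est _ _ s0 st).
  have /andP[d2 _] := dev _ (betahat v s) vc0 (pen_est _ _ s0 st).
  have /andP[_ d3] := dev _ beta vc0 (le_trans beta_s (le_trans st tB)).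
  have := estimate_emp_risk (est v s s0) beta_s.
  lra.
have := that_min s; rewrite /= in_itv/= s_in /cv_risk => /(_ isT).
rewrite ler_pM2l ?invr_gt0// => that_s.
have -> : 2 * (1 + B) ^+ 2 * cv_error mu V z = #|V|%:R^-1 *
    \sum_(v in V) (2 * D [set: 'I_n]%SET + D v + (D v + 2 * D (~: v)%SET)).
  rewrite /cv_error mulrCA mulr_sumr; congr (_ * _); apply: eq_bigr => v _.
  by rewrite /D; ring.
rewrite ler_pdivlMl//.
have sum1 : risk mu bf * #|V|%:R <= \sum_(v in V) emp_risk z v (betahat v that) +
    \sum_(v in V) (2 * D [set: 'I_n]%SET + D v).
  by rewrite mulr_natr -sumr_const -big_split/= ler_sum.
have sum2 : \sum_(v in V) emp_risk z v (betahat v s) <= risk mu beta * #|V|%:R +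
    \sum_(v in V) (D v + 2 * D (~: v)%SET).
  by rewrite mulr_natr -sumr_const -big_split/= ler_sum.
rewrite big_split/= mulrBr -/bf.
have := le_trans sum1 (lerD that_s (lexx _)).
rewrite -/(emp_risk _ _ _); move: sum2; rewrite /emp_risk; lra.
Qed.

End empirical_risk.

(** * Rates *)

Section rates.
Context (R : realType).

Lemma ln_nat_ge_half (p : nat) : (1 < p)%N -> 1 / 2 <= ln (p%:R : R).
Proof.
move=> p1; have p2 : 2 <= p%:R :> R by rewrite ler_nat.
rewrite -ler_expR lnK ?posrE; last by lra.
apply: le_trans p2.
have := expR_ge1Dx (- (1 / 2) : R); have e0 := expR_gt0 (1 / 2 : R).
move=> /(ler_wpM2l (ltW e0)); rewrite -expRD subrr expR0; lra.
Qed.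

Lemma powR_pow4 (x y : R) : (x `^ y) ^+ 4 = x `^ (y * 4).
Proof. by rewrite powRrM powR_mulrn// powR_ge0. Qed.

Lemma powR_quarter_pow4 (x : R) : 0 <= x -> (x `^ (1 / 4)) ^+ 4 = x.
Proof. by move=> x0; rewrite powR_pow4 (_ : 1 / 4 * 4 = 1) ?powRr1//; lra. Qed.

Lemma powR_log_factor_ge (L x : R) : 1 / 2 <= L -> 0 <= x -> x <= 1 / 2 ->
  L / 4 <= (L `^ (1 / 4 + x)) ^+ 4.
Proof.
move=> Lge x0 x1; have L0 : 0 < L by lra.
rewrite powR_pow4 (_ : (1 / 4 + x) * 4 = 1 + 4 * x); last lra.
rewrite powRD; last by rewrite (gt_eqF L0) implybT.
rewrite powRr1 ?(ltW L0)// ler_pM2l//.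
have [L1|L1] := leP 1 L.
  have : L `^ 0 <= L `^ (4 * x) by apply: ler_powR => //; lra.
  by rewrite powRr0; lra.
have L01 : 0 < L <= 1 by rewrite L0 ltW.
have : L `^ 2%:R <= L `^ (4 * x) by apply: ger_powR => //; lra.
by rewrite powR_mulrn ?(ltW L0)//; nra.
Qed.

Lemma inv2q_itv (q : \bar R) : (1 <= q)%E -> 0 <= inv2q q <= 1 / 2.
Proof.
case: q => [r| |]//=; last by move=> _; rewrite lexx; lra.
rewrite lee_fin => r1; rewrite invr_ge0 mulr_ge0/=; last 2 first.
- by [].
- lra.
by rewrite div1r lef_pV2 ?posrE; lra.
Qed.

Lemma q_over_q2_le1 (q : \bar R) : (1 <= q)%E -> q_over_q2 q <= 1.
Proof.
case: q => [r| |]//=; rewrite lee_fin => r1.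
by rewrite ler_pdivrMr; lra.
Qed.

(** The first domination forces b_n to be eventually positive: a power of a
    nonpositive number is at most 1, while m_n tends to infinity.  Once
    b_n >= 1, its power of exponent q / (q + 2) <= 1 is at most b_n. *)
Lemma rate_facts (q : \bar R) (p : nat -> nat) (b m : nat -> R) (eps C : R) :
  (1 <= q)%E -> (\forall n \near \oo, (1 < p n)%N) ->
  m n @[n --> \oo] --> +oo ->
  m =o_\oo (fun n => b n `^ (1 / 4)) ->
  (fun n => ln (p n)%:R : R) =o_\oo (fun n => b n `^ q_over_q2 q) ->
  0 < eps ->
  \forall n \near \oo, [/\ C <= m n, m n ^+ 4 <= b n, 1 / 2 <= ln (p n)%:R :> R
    & ln (p n)%:R <= eps * b n].
Proof.
move=> q1 p1 moo /eqoP mb /eqoP pb eps0.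
have th1 := q_over_q2_le1 q1.
have m2 : \forall n \near \oo, Num.max 2 C <= m n by move/cvgryPge : moo; exact.
have mb1 := mb 1 ltr01; have pbe := pb eps eps0.
near=> n.
have p1n : (1 < p n)%N by near: n.
have /andP[m2n mC] : (2 <= m n) && (C <= m n) by rewrite -ge_max; near: n.
have mb1n : `|m n| <= 1 * `|b n `^ (1 / 4)| by near: n.
have pben : `|ln (p n)%:R| <= eps * `|b n `^ q_over_q2 q| by near: n.
have m0 : 0 < m n by lra.
have {}mb1n : m n <= b n `^ (1 / 4).
  by move: mb1n; rewrite mul1r !ger0_norm ?powR_ge0// ltW.
have b0 : 0 < b n.
  rewrite ltNge le_eqVlt; apply/negP => /orP[/eqP b0|b0].
    by move: mb1n; rewrite b0 powR0; [lra|rewrite gt_eqF//; lra].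
  by move: mb1n; rewrite lt0_powR1//; lra.
have mb4 : m n ^+ 4 <= b n.
  rewrite -[leRHS](powR_quarter_pow4 (ltW b0)) lerXn2r// nnegrE; first lra.
  exact: powR_ge0.
have b1 : 1 <= b n.
  by apply: le_trans mb4; rewrite exprn_ege1//; lra.
have L12 := ln_nat_ge_half p1n.
split => //; move: pben; rewrite (ger0_norm (powR_ge0 _ _)) ger0_norm; last lra.
move=> /le_trans; apply; rewrite ler_pM2l//.
by have := ler_powR b1 th1; rewrite powRr1 ?(ltW b0).
Unshelve. all: by end_near. Qed.

(** Here C b / (m^4 log p) bounds B^4.  As (1 + B)^4 <= 8 (1 + B^4), the claim
    Gam (log p + m^2) <= b (eta / (1 + B)^2)^2 splits into one inequality for
    the summand 1 and one for B^4, and each of them holds for m and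
    b / log p large.  The factor 2 (p + 1)^2 is absorbed by
    p^5 = exp (5 log p). *)
Lemma tail_bound_le (p : nat) (b m B eta kappa delta C Gam : R) :
  (1 < p)%N -> 0 < eta -> 0 < kappa -> 0 < delta -> 0 <= B -> 0 <= C ->
  10 <= kappa * Gam -> 2 * delta <= kappa * Gam -> 0 < Gam ->
  let L := ln (p%:R : R) in
  m ^+ 4 * L * B ^+ 4 <= C * b ->
  m ^+ 4 <= b -> L <= eta ^+ 2 / (32 * Gam) * b ->
  1 <= m -> 32 * Gam <= eta ^+ 2 * m -> 48 * Gam * C <= eta ^+ 2 * m ->
  2 * p.+1%:R ^+ 2 * expR (- (kappa / 2 * (b * (eta / (1 + B) ^+ 2) ^+ 2))) <=
    (m ^+ 2 * delta)^-1.
Proof.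
move=> p1 eta0 kappa0 delta0 B0 C0 kG10 kGd G0 L LB mb Lb m1 mG mC.
have L12 : 1 / 2 <= L by exact: ln_nat_ge_half.
have p2 : 2 <= p%:R :> R by rewrite ler_nat.
set y := b * _.
have m0 : 0 < m by lra.
have m2 : m <= m ^+ 2 by rewrite expr2; nra.
have m24 : m ^+ 2 * m ^+ 2 = m ^+ 4 by rewrite -exprD.
have m20 : 0 < m ^+ 2 by rewrite exprn_gt0; lra.
have b0 : 0 < b by apply: lt_le_trans mb; rewrite exprn_gt0; lra.
have B40 : 0 <= B ^+ 4 by exact: exprn_ge0.
have e20 : 0 < eta ^+ 2 by exact: exprn_gt0.
have h1 : 32 * Gam * (L + m ^+ 2) <= 2 * eta ^+ 2 * b.
  have : 32 * Gam * L <= eta ^+ 2 * b.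
    move: Lb; rewrite mulrAC ler_pdivlMr; last lra.
    by rewrite mulrC.
  have : 32 * Gam * m ^+ 2 <= eta ^+ 2 * b.
    apply: (@le_trans _ _ (eta ^+ 2 * m * m ^+ 2)); first by rewrite ler_wpM2r// ltW.
    rewrite -mulrA ler_pM2l//; apply: le_trans mb; rewrite -m24.
    by rewrite ler_wpM2r// ltW.
  lra.
have h2 : 16 * Gam * ((L + m ^+ 2) * B ^+ 4) <= eta ^+ 2 * b.
  (* As 1 / 2 <= L and 1 <= m, the sum L + m^2 is at most 3 L m^2. *)
  have k1 : L + m ^+ 2 <= 3 * (L * m ^+ 2) by nra.
  have k2 : (L + m ^+ 2) * B ^+ 4 * m ^+ 2 <= 3 * (C * b).
    apply: (@le_trans _ _ (3 * (L * m ^+ 2) * B ^+ 4 * m ^+ 2)).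
      by rewrite ler_wpM2r ?(ltW m20)// ler_wpM2r.
    by rewrite (_ : _ * m ^+ 2 = 3 * (m ^+ 4 * L * B ^+ 4)) ?ler_pM2l// -m24; ring.
  rewrite -(ler_pM2r m20).
  apply: (@le_trans _ _ (48 * Gam * C * b)).
    rewrite (_ : 48 * Gam * C * b = 16 * Gam * (3 * (C * b))); last by ring.
    by rewrite -[leLHS]mulrA ler_pM2l// mulr_gt0.
  rewrite (_ : eta ^+ 2 * b * m ^+ 2 = eta ^+ 2 * m ^+ 2 * b); last by ring.
  rewrite ler_pM2r//; apply: le_trans mC _.
  by rewrite ler_pM2l.
have B1 : (1 + B) ^+ 4 <= 8 * (1 + B ^+ 4).
  have : (1 + B) ^+ 4 = ((1 + B) ^+ 2) ^+ 2 by rewrite -exprM.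
  have : B ^+ 4 = (B ^+ 2) ^+ 2 by rewrite -exprM.
  move=> -> ->; have : (1 + B) ^+ 2 <= 2 * (1 + B ^+ 2).
    by rewrite -subr_ge0; have := sqr_ge0 (1 - B); lra.
  have := sqr_ge0 (1 - B ^+ 2); have : 0 <= (1 + B) ^+ 2 by exact: sqr_ge0.
  nra.
have yE : y * (1 + B) ^+ 4 = eta ^+ 2 * b.
  by rewrite /y; field; rewrite gt_eqF//; lra.
have B40' : 0 < (1 + B) ^+ 4 by rewrite exprn_gt0//; lra.
have yG : Gam * (L + m ^+ 2) <= y.
  rewrite -(ler_pM2r B40') yE.
  apply: (@le_trans _ _ (Gam * (L + m ^+ 2) * (8 * (1 + B ^+ 4)))).
    by rewrite ler_pM2l// mulr_gt0//; lra.
  have := h1; have := h2; lra.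
have ky : 5 * L + delta * m ^+ 2 <= kappa / 2 * y.
  apply: (@le_trans _ _ (kappa / 2 * (Gam * (L + m ^+ 2)))); last first.
    by rewrite ler_pM2l//; lra.
  have : 10 * L <= kappa * Gam * L by rewrite ler_pM2r//; lra.
  have : 2 * delta * m ^+ 2 <= kappa * Gam * m ^+ 2 by rewrite ler_pM2r.
  lra.
apply: (@le_trans _ _ (expR (5 * L) * expR (- (5 * L + delta * m ^+ 2)))).
  apply: ler_pM; rewrite ?expR_ge0 ?mulr_ge0 ?sqr_ge0 ?ler_expR ?lerN2//.
  rewrite (mulrC 5 L) expRM_natr lnK ?posrE; last lra.
  rewrite -natr1; set x : R := p%:R in p2 *.
  have -> : x ^+ 5 = x ^+ 2 * x ^+ 3 by rewrite -exprD.
  have : 2 ^+ 3 <= x ^+ 3 by rewrite lerXn2r ?nnegrE//; lra.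
  have : 0 <= x ^+ 2 by exact: sqr_ge0.
  by nra.
rewrite -expRD opprD addrA subrr add0r expRN mulrC lef_pV2 ?posrE ?expR_gt0 ?mulr_gt0//.
by have := expR_ge1Dx (m ^+ 2 * delta); lra.
Qed.

(** The factor (log p)^(2/q) left over from (log p)^(1 + 2/q) is at least 1/4,
    as log p >= 1/2 and 2 / q <= 2. *)
Lemma rate_pow4_le (q : \bar R) (b m L M : R) :
  (1 <= q)%E -> 0 <= b -> 0 < m -> 1 / 2 <= L ->
  m ^+ 4 * L * ((M + 1) * (b `^ (1 / 4) / (m * L `^ (1 / 4 + inv2q q)))) ^+ 4 <=
    4 * (M + 1) ^+ 4 * b.
Proof.
move=> q1 b0 m0 L12; have /andP[iq0 iq1] := inv2q_itv q1.
rewrite exprMn expr_div_n exprMn powR_quarter_pow4//.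
have := powR_log_factor_ge L12 iq0 iq1; set T := (_ `^ _) ^+ 4 => LT.
have T0 : 0 < T by lra.
rewrite (_ : _ * _ = (L / T) * ((M + 1) ^+ 4 * b)); last first.
  by field; rewrite !gt_eqF.
rewrite -[leRHS]mulrA; apply: ler_wpM2r.
  by rewrite mulr_ge0// exprn_even_ge0.
by rewrite ler_pdivrMr//; lra.
Qed.

End rates.

(** * Tail of the excess risk *)

Section excess_risk.
Context (R : realType).

Lemma risk_ge0 (p : nat) (mu : probability (p.+1.-tuple R) R) (beta : 'cV[R]_p) :
  0 <= risk mu beta.
Proof.
by rewrite /risk fine_ge0// unlock integral_ge0// => z _; rewrite lee_fin sqr_ge0.
Qed.

Lemma residual0 (p : nat) (z : p.+1.-tuple R) :
  residual z (0 : 'cV[R]_p) = response z.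
Proof. by rewrite /residual big1 ?subr0// => j _; rewrite mxE mulr0. Qed.

Lemma moment_error_le_cv_error (p n : nat) (mu : probability (p.+1.-tuple R) R)
    (V : {set {set 'I_n}}) (z : 'I_n -> p.+1.-tuple R) :
  V != finset.set0 -> moment_error mu z [set: 'I_n]%SET <= cv_error mu V z.
Proof.
rewrite -card_gt0 => V0; have cV0 : 0 < #|V|%:R :> R by rewrite ltr0n.
rewrite /cv_error ler_pdivlMl// mulr_natl -sumr_const ler_sum// => v _.
by rewrite -addrA lerDl addr_ge0// moment_error_ge0.
Qed.

(** Chosen so that cv_error <= 3 risk_tolerance yields an excess risk of at most
    delta / 2 in the oracle inequality on the ball of radius B, and a deviation
    of the mean of Y^2 of at most min (1, delta / 4). *)
Definition risk_tolerance (delta B : R) : R :=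
  Num.min (1 / 3) (delta / 12) / (1 + B) ^+ 2.

(** The mean of Y^2 is the empirical risk of the null vector, so its deviation is
    one more instance of [emp_risk_uniform], with B = 0.  The level t need not
    be below the largest candidate parameter if E Y^2 is small, but then the
    null vector, feasible at level 0, is good enough. *)
Lemma excess_risk_le (k : lasso) (n p : nat) (mu : probability (p.+1.-tuple R) R)
    (K c : R) (G : {set {set 'I_p}}) (z : 'I_n -> p.+1.-tuple R)
    (V : {set {set 'I_n}}) (betahat : {set 'I_n} -> R -> 'cV[R]_p)
    (that t rate M delta : R) (betastar : 'cV[R]_p) :
  0 < K -> (forall j k : 'I_p.+1,
    (\int[mu]_z (expR (`|centered_product mu j k z| / K))%:E <= c%:E)%E) ->
  finset.partition G [set: 'I_p]%SET -> V != finset.set0 -> (0 < n)%N ->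
  (forall v, v \in V -> (0 < #|v|)%N /\ (0 < #|(~: v)%SET|)%N) ->
  (forall v s, 0 <= s -> is_estimate k G z v s (betahat v s)) ->
  is_argmin `[0, emp_risk z [set: 'I_n]%SET 0 * rate]
    (cv_risk V z betahat) that ->
  0 < delta -> 0 <= rate -> risk mu 0 <= M -> t <= delta / 4 * rate ->
  penalty k G betastar <= t ->
  cv_error mu V z <= 3 * risk_tolerance delta ((M + 1) * rate) ->
  risk mu (betahat finset.set0 that) - risk mu betastar <= delta.
Proof.
move=> K0 momK partG V0 n0 VP est argmin_that delta0 rate0 riskM t_rate pen_t.
set B := (M + 1) * rate; rewrite /risk_tolerance.
set eta := Num.min _ _ => errB.
have M0 : 0 <= M by apply: le_trans riskM; exact: risk_ge0.
have B0 : 0 <= B by rewrite mulr_ge0//; lra.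
have eta1 : eta <= 1 / 3 by rewrite ge_min lexx.
have eta2 : eta <= delta / 12 by rewrite ge_min lexx orbT.
have eta0 : 0 < eta by rewrite lt_min; apply/andP; split; lra.
have B2 : 1 <= (1 + B) ^+ 2 by rewrite exprn_ege1//; lra.
have B20 : 0 < (1 + B) ^+ 2 by lra.
have errE : (1 + B) ^+ 2 * cv_error mu V z <= 3 * eta.
  by rewrite mulrC -ler_pdivlMr// -mulrA.
have err_eta : cv_error mu V z <= 3 * eta.
  apply: le_trans errE; rewrite ler_peMl//.
  by apply: le_trans (moment_error_le_cv_error _ _ V0); exact: moment_error_ge0.
have cT : (0 < #|[set: 'I_n]%SET|)%N by rewrite cardsT card_ord.
have mean_dev : `|emp_risk z [set: 'I_n]%SET 0 - risk mu 0| <= 3 * eta.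
  apply: le_trans err_eta; apply: le_trans (moment_error_le_cv_error _ _ V0).
  have := @emp_risk_uniform R p mu K c K0 momK n z _ 0 0 cT.
  rewrite addr0 expr1n mul1r; apply.
  by rewrite big1// => j _; rewrite mxE normr0.
move: mean_dev; rewrite ler_distl => /andP[mean_ge mean_le].
have oracle s beta : 0 <= s -> s <= emp_risk z [set: 'I_n]%SET 0 * rate ->
    penalty k G beta <= s ->
    risk mu (betahat finset.set0 that) - risk mu beta <= delta / 2.
  move=> s0 s_le pen_s.
  apply: le_trans (cv_oracle (B := B) K0 momK partG V0 n0 VP est argmin_that _ pen_s _) _.
  - by rewrite s0.
  - rewrite /B ler_wpM2r//; lra.
  - by rewrite -mulrA; lra.
(* At small E Y^2, comparison with the null vector at level 0. *)
have [small|large] := ltP (risk mu 0) (delta / 2).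
  have := oracle 0 0 (lexx _); rewrite penalty0 lexx.
  have emp0 : 0 <= emp_risk z [set: 'I_n]%SET 0 * rate.
    apply: mulr_ge0 => //; rewrite /emp_risk mulr_ge0// sumr_ge0// => i _.
    exact: sqr_ge0.
  by move=> /(_ emp0 isT); have := risk_ge0 mu betastar; lra.
have t0 : 0 <= t by apply: le_trans pen_t; exact: penalty_ge0.
have t_le : t <= emp_risk z [set: 'I_n]%SET 0 * rate.
  by apply: le_trans t_rate _; rewrite ler_wpM2r//; lra.
by have := oracle t betastar t0 t_le pen_t; lra.
Qed.

(** [cv_error_tail] at nu = kappa b s, where s is the tolerance: kappa is small
    enough for the quadratic term of the exponent to be at most half of the
    linear one, and for nu to stay in the range of [mgf_le]. *)
Lemma excess_risk_tail (k : lasso) (n p : nat) (mu : probability (p.+1.-tuple R) R)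
    (d : measure_display) (Omega : measurableType d) (P : probability Omega R)
    (Z : 'I_n -> {RV P >-> p.+1.-tuple R}) (K : R) (G : {set {set 'I_p}})
    (V : {set {set 'I_n}}) (betahat : Omega -> {set 'I_n} -> R -> 'cV[R]_p)
    (that : Omega -> R) (t rate M delta A b kappa : R) (betastar : 'cV[R]_p) :
  let D := 16 * (2 * expR 1) * K ^+ 2 in
  let eta := Num.min (1 / 3) (delta / 12) in
  let B := (M + 1) * rate in
  iid_sample mu Z -> 0 < K ->
  (forall j k : 'I_p.+1,
    (\int[mu]_z (expR (`|centered_product mu j k z| / K))%:E <=
      (2 * expR 1)%:E)%E) ->
  finset.partition G [set: 'I_p]%SET -> V != finset.set0 ->
  0 < A -> 0 < b -> A * b <= n%:R ->
  (forall v, v \in V -> A * b <= #|v|%:R /\ A * b <= #|(~: v)%SET|%:R) ->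
  (forall w v s, 0 <= s ->
    is_estimate k G (fun i => Z i w) v s (betahat w v s)) ->
  (forall w, is_argmin `[0, emp_risk (fun i => Z i w) [set: 'I_n]%SET 0 * rate]
    (cv_risk V (fun i => Z i w) (betahat w)) (that w)) ->
  0 < delta -> 0 <= rate -> risk mu 0 <= M -> t <= delta / 4 * rate ->
  penalty k G betastar <= t ->
  0 < kappa -> kappa * (2 * D) <= A -> kappa * (2 * K * eta) <= A ->
  (outer_probability P [set w | (delta <
      risk mu (betahat w finset.set0 (that w)) - risk mu betastar)%R] <=
    (2 * p.+1%:R ^+ 2 *
      expR (- (kappa / 2 * (b * (eta / (1 + B) ^+ 2) ^+ 2))))%:E)%E.
Proof.
move=> D eta B iidZ K0 momK partG V0 A0 b0 bn bV est argmin_that delta0 rate0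
  riskM t_rate pen_t kappa0 kappaD kappaK.
have M0 : 0 <= M by apply: le_trans riskM; exact: risk_ge0.
have eta0 : 0 < eta by rewrite lt_min !divr_gt0.
have B0 : 0 <= B by rewrite mulr_ge0// addr_ge0.
have B2 : 1 <= (1 + B) ^+ 2 by rewrite exprn_ege1// lerDl.
have B20 : 0 < (1 + B) ^+ 2 by exact: lt_le_trans B2.
have bA0 : 0 < A * b by exact: mulr_gt0.
pose s := risk_tolerance delta B.
have s0 : 0 < s by exact: divr_gt0.
have s_eta : s <= eta by rewrite /s /risk_tolerance ler_pdivrMr// ler_peMr// ltW.
pose nu := kappa * (b * s).
have nu0 : 0 < nu by apply: mulr_gt0 => //; exact: mulr_gt0.
have nuK : nu / (A * b) <= (2 * K)^-1.
  have -> : nu / (A * b) = kappa * s / A by rewrite /nu; field; rewrite !gt_eqF.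
  rewrite ler_pdivrMr// ler_pdivlMl ?mulr_gt0//; apply: le_trans kappaK.
  rewrite [leRHS](_ : _ = 2 * K * (kappa * eta)); last by ring.
  by rewrite ler_pM2l ?mulr_gt0// ler_pM2l.
have n0 : (0 < n)%N by rewrite -(ltr0n R); exact: lt_le_trans bn.
have large_error w : (delta <
      risk mu (betahat w finset.set0 (that w)) - risk mu betastar)%R ->
    3 * s < cv_error mu V (fun i => Z i w).
  apply: contraTT; rewrite -!leNgt => err.
  apply: (@excess_risk_le k n p mu K (2 * expR 1) G (fun i => Z i w)
    V (betahat w) (that w) t rate M delta) => //.
  - move=> v /bV[bv bvc].
    by split; rewrite -(ltr0n R); apply: lt_le_trans bA0 _.
  - exact: est.
have mom0 := integral_centered_product K0 momK.
apply: (@le_trans _ _ (outer_probability P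
    [set w | (3 * s < cv_error mu V (fun i => Z i w))%R])).
  by apply: le_mu_ext => w; exact: large_error.
apply: le_trans (cv_error_tail s iidZ K0 momK mom0 V0 bA0 bn bV nu0 nuK) _.
rewrite lee_fin ler_wpM2l ?mulr_ge0 ?sqr_ge0// ler_expR -/D -[eta / _]/s.
have -> : nu ^+ 2 / (A * b) = kappa ^+ 2 / A * (b * s ^+ 2).
  by rewrite /nu; field; rewrite !gt_eqF.
have -> : nu * s = kappa * (b * s ^+ 2) by rewrite /nu; ring.
set y := b * s ^+ 2.
have y0 : 0 <= y by rewrite mulr_ge0 ?(ltW b0)// sqr_ge0.
have kD : D * (kappa ^+ 2 / A) <= kappa / 2.
  rewrite mulrA ler_pdivrMr// (_ : D * _ = kappa / 2 * (kappa * (2 * D))).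
    by rewrite ler_pM2l// divr_gt0.
  by field.
by have := ler_wpM2r y0 kD; lra.
Qed.

End excess_risk.

(** * Risk consistency *)

Theorem corollary2 (R : realType) (k : lasso) (q : \bar R) (p : nat -> nat)
    (G : forall n, {set {set 'I_(p n)}})
    (mu : forall n, probability ((p n).+1.-tuple R) R)
    (f : forall n, (p n).-tuple R -> R)
    (d : nat -> measure_display) (Omega : forall n, measurableType (d n))
    (P : forall n, probability (Omega n) R)
    (Z : forall n, 'I_n -> {RV (P n) >-> (p n).+1.-tuple R})
    (V : forall n, {set {set 'I_n}})
    (b c m a t : nat -> R) (tmax : forall n, Omega n -> R)
    (betahat : forall n, Omega n -> {set 'I_n} -> R -> 'cV[R]_(p n))
    (that : forall n, Omega n -> R)
    (betastar : forall n, 'cV[R]_(p n)) :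
  (1 <= q)%E ->
  (\forall n \near \oo, (1 < p n)%N) ->
  (forall n, finset.partition (G n) [set: 'I_(p n)]%SET) ->
  in_class q mu ->
  (forall n, regression_model (mu n) (f n)) ->
  (forall n, iid_sample (mu n) (Z n)) ->
  ((q < +oo)%E -> exists M : R, \forall n \near \oo,
    ('E_(mu n)[fun z => (response z ^+ 2)%R] <= M%:E)%E) ->
  (forall n, (V n != finset.set0)) ->
  (exists A B : R, 0 < A /\ \forall n \near \oo, forall v, v \in V n ->
    A * c n <= #|v|%:R <= B * c n) ->
  (exists A : R, 0 < A /\ \forall n \near \oo, forall v, v \in V n ->
    A * (n%:R - c n) <= n%:R - #|v|%:R) ->
  (forall n, b n = Num.min (n%:R - c n) (c n)) ->
  m n @[n --> \oo] --> +oo ->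
  m =o_\oo (fun n => b n `^ (1 / 4)) ->
  (forall n, a n =
    n%:R * ln (p n)%:R `^ (1 / 4 + inv2q q) * m n / b n `^ (1 / 4)) ->
  t =o_\oo (fun n =>
    b n `^ (1 / 4) / (m n * ln (p n)%:R `^ (1 / 4 + inv2q q))) ->
  (fun n => ln (p n)%:R : R) =o_\oo (fun n => b n `^ q_over_q2 q) ->
  (k = GroupLasso -> exists M : R, \forall n \near \oo,
    forall g, g \in G n -> Num.sqrt #|g|%:R <= M) ->
  (forall n w, tmax n w = (\sum_(i < n) response (Z n i w) ^+ 2) / a n) ->
  (forall n w v s, 0 <= s ->
    is_estimate k (G n) (fun i => Z n i w) v s (betahat n w v s)) ->
  (\forall n \near \oo, forall w,
    is_argmin `[0, tmax n w]
      (cv_risk (V n) (fun i => Z n i w) (betahat n w)) (that n w)) ->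
  (\forall n \near \oo,
    is_argmin (constraint_set k (G n) (t n)) (risk (mu n)) (betastar n)) ->
  forall delta : R, 0 < delta -> \forall n \near \oo,
    (outer_probability (P n) [set w | (delta <
        risk (mu n) (betahat n w finset.set0 (that n w))
        - risk (mu n) (betastar n))%R]
     <= ((m n ^+ 2 * delta)^-1 * (1 + Num.sqrt (b n / n%:R))
         + 2 * expR (- (n%:R / (8 * expR 1 ^+ 2))))%:E)%E.
Proof.
move=> q1 p1 partG muq _ iidZ EY2 V0 [A1 [A2 [A10 cardV]]] [A3 [A30 cardVC]] bE moo mb
  aE tE Lb _ tmaxE est that_min star_min delta delta0.
have [K K0 momK] := in_class_exp_moment q1 muq.
have [M0 EM0] := in_class_response q1 muq EY2.
pose M := Num.max 0 M0.
have M_ge0 : 0 <= M by rewrite le_max lexx.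
have EM : \forall n \near \oo, risk (mu n) 0 <= M.
  move: EM0; apply: filterS => n; rewrite /risk.
  rewrite (_ : (fun z => (residual z 0 ^+ 2)%R) = (fun z => (response z ^+ 2)%R)); last first.
    by apply/funext => z; rewrite residual0.
  case: ('E_(mu n)[_])%E => [x| |] //=; rewrite ?lee_fin le_max ?lexx//.
  by move=> ->; rewrite orbT.
pose eta : R := Num.min (1 / 3) (delta / 12).
have eta0 : 0 < eta by rewrite lt_min !divr_gt0.
pose D := 16 * (2 * expR 1) * K ^+ 2 : R.
have D0 : 0 < D by rewrite /D !mulr_gt0// ?expR_gt0// exprn_gt0.
pose A := Num.min (Num.min A1 A3) 1.
have A0 : 0 < A by rewrite !lt_min A10 A30/=.
(* Both members of the minimum are upper limits imposed by the tail bound. *)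
pose kappa := Num.min (A / (2 * D)) (A / (2 * K * eta)).
have kappa0 : 0 < kappa by rewrite lt_min !divr_gt0// !mulr_gt0.
have kappa1 : kappa * (2 * D) <= A.
  by rewrite -ler_pdivlMr ?mulr_gt0// ge_min lexx.
have kappa2 : kappa * (2 * K * eta) <= A.
  by rewrite -ler_pdivlMr ?mulr_gt0// ge_min lexx orbT.
pose Gam := (10 + 2 * delta) / kappa.
have Gam0 : 0 < Gam by rewrite divr_gt0// addr_gt0// mulr_gt0.
have kGam : kappa * Gam = 10 + 2 * delta by rewrite /Gam mulrC divfK// gt_eqF.
pose C := 4 * (M + 1) ^+ 4.
have C0 : 0 <= C by rewrite mulr_ge0// exprn_ge0// addr_ge0.
(* How large m_n must be for the rates to compare. *)
pose C1 := Num.max 1 (Num.max (32 * Gam / eta ^+ 2) (48 * Gam * C / eta ^+ 2)).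
have eta20 : 0 < eta ^+ 2 by exact: exprn_gt0.
have eps0 : 0 < eta ^+ 2 / (32 * Gam) by rewrite divr_gt0// mulr_gt0.
have facts := rate_facts C1 q1 p1 moo mb Lb eps0.
have delta4 : 0 < delta / 4 by exact: divr_gt0.
move/eqoP : tE => /(_ (delta / 4) delta4) tE.
near=> n.
have p1n : (1 < p n)%N by near: n.
have [mC1 mbn L12 Lbn] : [/\ C1 <= m n, m n ^+ 4 <= b n, 1 / 2 <= ln (p n)%:R :> R
    & ln (p n)%:R <= eta ^+ 2 / (32 * Gam) * b n] by near: n.
have EMn : risk (mu n) 0 <= M by near: n.
have cardVn : forall v, v \in V n -> A1 * c n <= #|v|%:R <= A2 * c n by near: n.
have cardVCn : forall v, v \in V n -> A3 * (n%:R - c n) <= n%:R - #|v|%:R by near: n.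
have that_minn : forall w, is_argmin `[0, tmax n w]
      (cv_risk (V n) (fun i => Z n i w) (betahat n w)) (that n w) by near: n.
have [pen_star _] : is_argmin (constraint_set k (G n) (t n)) (risk (mu n)) (betastar n).
  by near: n.
have tEn : `|t n| <= delta / 4 *
    `|b n `^ (1 / 4) / (m n * ln (p n)%:R `^ (1 / 4 + inv2q q))| by near: n.
set L := ln (p n)%:R in L12 Lbn tEn *.
set rate := b n `^ (1 / 4) / (m n * L `^ (1 / 4 + inv2q q)) in tEn.
move: mC1; rewrite !ge_max !ler_pdivrMr// => /andP[m1 /andP[mG mC]].
have m0 : 0 < m n by exact: lt_le_trans m1.
have b0 : 0 < b n by apply: lt_le_trans mbn; exact: exprn_gt0.
have L0 : 0 < L by apply: lt_le_trans L12; exact: divr_gt0.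
have rate0 : 0 < rate by rewrite divr_gt0 ?mulr_gt0 ?powR_gt0.
have bc : b n <= c n by rewrite bE ge_min lexx orbT.
have bnc : b n <= n%:R - c n by rewrite bE ge_min lexx.
have bn : b n <= n%:R.
  by apply: le_trans bnc _; rewrite gerBl (le_trans (ltW b0)).
have n0 : 0 < n%:R :> R by exact: lt_le_trans bn.
have tn : t n <= delta / 4 * rate.
  by apply: le_trans (ler_norm _) _; rewrite -[in leRHS](gtr0_norm rate0).
have NV v : v \in V n -> A * b n <= #|v|%:R /\ A * b n <= #|(~: v)%SET|%:R.
  move=> vV; split.
    have /andP[h _] := cardVn v vV; apply: le_trans h.
    by apply: ler_pM; rewrite ?(ltW A0) ?(ltW b0)// !ge_min lexx.
  have -> : #|(~: v)%SET|%:R = n%:R - #|v|%:R :> R.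
    by apply/eqP; rewrite eq_sym subr_eq -natrD addnC cardsC card_ord.
  apply: le_trans (cardVCn v vV).
  by apply: ler_pM; rewrite ?(ltW A0) ?(ltW b0)// !ge_min lexx ?orbT.
have Nn : A * b n <= n%:R.
  by apply: le_trans bn; rewrite ler_piMl ?(ltW b0)// ge_min lexx orbT.
have tmaxn w : tmax n w = emp_risk (fun i => Z n i w) [set: 'I_n]%SET 0 * rate.
  rewrite tmaxE aE /emp_risk cardsT card_ord /rate -/L.
  under [in RHS]eq_bigl do rewrite inE.
  under [in RHS]eq_bigr do rewrite residual0.
  by field; rewrite !gt_eqF ?powR_gt0.
have argmin_that w : is_argmin
    `[0, emp_risk (fun i => Z n i w) [set: 'I_n]%SET 0 * rate]
    (cv_risk (V n) (fun i => Z n i w) (betahat n w)) (that n w).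
  by rewrite -tmaxn.
apply: le_trans (excess_risk_tail (iidZ n) K0 (momK n) (partG n) (V0 n) A0 b0 Nn
  NV (est n) argmin_that delta0 (ltW rate0) EMn tn pen_star kappa0 kappa1 kappa2) _.
rewrite lee_fin -/eta; apply: (@le_trans _ _ ((m n ^+ 2 * delta)^-1)).
  apply: (@tail_bound_le R (p n) (b n) (m n) _ eta kappa delta C Gam) => //.
  - by rewrite mulr_ge0 ?(ltW rate0)// addr_ge0.
  - by rewrite kGam lerDl mulr_ge0// ltW.
  - by rewrite kGam lerDr.
  - exact: (rate_pow4_le M q1 (ltW b0) m0 L12).
  - by rewrite [leRHS]mulrC.
  - by rewrite [leRHS]mulrC.
have m20 : 0 <= (m n ^+ 2 * delta)^-1.
  by rewrite invr_ge0 mulr_ge0 ?sqr_ge0// ltW.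
rewrite mulrDr mulr1 -addrA lerDl addr_ge0// mulr_ge0 ?sqrtr_ge0 ?expR_ge0//.
Unshelve. all: by end_near. Qed.
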